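(* Let $R$ be a commutative ring with unity, let $\mathcal{D}$ be a small category, let $F:\mathcal{D}\to\mathbf{Cat}$ be a functor to the category of small categories, let $\int_{\mathcal{D}}F$ be its Grothendieck construction and let $\pi:\int_{\mathcal{D}}F\to\mathcal{D}$ be the forgetful functor. For every coefficient system $M:\Delta\bigl(N\int_{\mathcal{D}}F\bigr)\to R\text{-Mod}$ there is a first quadrant (cohomological) spectral sequence $$E_2^{p,q}=H^p\bigl(\mathcal{D}^{op};\,H^q_{Th}(\pi/-;\,j^*M)\bigr)\;\Longrightarrow\;H^{p+q}_{Th}\Bigl(\int_{\mathcal{D}}F;\,M\Bigr).$$
   Context: Grothendieck construction: objects of $\int_{\mathcal{D}}F$ are pairs $(d,x)$ with $d$ an object of $\mathcal{D}$ and $x$ an object of $F(d)$; a morphism $(\alpha,\gamma):(d,x)\to(d',x')$ consists of $\alpha:d\to d'$ in $\mathcal{D}$ and $\gamma:F(\alpha)(x)\to x'$ in $F(d')$. The functor $\pi$ sends $(d,x)$ to $d$ and $(\alpha,\gamma)$ to $\alpha$. For an object $d$ of $\mathcal{D}$, $\pi/d$ is the comma category with objects $((d',x'),\mu)$, where $\mu:\pi(d',x')=d'\to d$ is a morphism of $\mathcal{D}$, and with morphisms those morphisms of $\int_{\mathcal{D}}F$ compatible with the maps to $d$; $j:\pi/d\to\int_{\mathcal{D}}F$ sends $((d',x'),\mu)$ to $(d',x')$. A morphism $\beta:d\to d'$ induces a functor $\beta_*:\pi/d\to\pi/d'$ by composing $\mu$ with $\beta$, and $j\circ\beta_*=j$.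 For a simplicial set $X$, the category of simplices $\Delta(X)$ has objects $([n],\sigma)$ with $\sigma\in X_n$ (written simply $\sigma$), and morphisms $([m],\tau)\to([n],\sigma)$ are the morphisms $f:[m]\to[n]$ of the simplex category $\Delta$ with $f^*\sigma=\tau$. A coefficient system on $X$ is a functor $M:\Delta(X)\to R\text{-Mod}$. Let $C(X;M)$ be the cosimplicial $R$-module with $C^n(X;M)=\prod_{\sigma\in X_n}M(\sigma)$ and, for $f:[m]\to[n]$, $(f^*\zeta)(\sigma)=M(f)(\zeta(f^*\sigma))$. The Gabriel-Zisman cohomology $H^\bullet(X;M)$ is the cohomology of $C(X;M)$, i.e. of the cochain complex with differential the alternating sum of the coface maps. For a small category $\mathcal{C}$ and a coefficient system $M$ on its nerve $N\mathcal{C}$, the Thomason cohomology is $H^\bullet_{Th}(\mathcal{C};M):=H^\bullet(N\mathcal{C};M)$. A functor $\psi:\mathcal{A}\to\mathcal{B}$ pulls a coefficient system $M$ on $N\mathcal{B}$ back to $\psi^*M=M\circ\Delta(N\psi)$ on $N\mathcal{A}$, where $\Delta(N\psi):\Delta(N\mathcal{A})\to\Delta(N\mathcal{B})$ is the functor induced by $N\psi$; the cochain map $(\psi^*\zeta)(\sigma)=\zeta(N\psi(\sigma))$ induces $\psi^*:H^\bullet_{Th}(\mathcal{B};M)\to H^\bullet_{Th}(\mathcal{A};\psi^*M)$. $H^q_{Th}(\pi/-;j^*M):\mathcal{D}^{op}\to R\text{-Mod}$ is the functor $d\mapsto H^q_{Th}(\pi/d;j^*M)$, with a morphism $\beta:d\to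 d'$ of $\mathcal{D}$ acting by $(\beta_* )^*:H^q_{Th}(\pi/d';j^*M)\to H^q_{Th}(\pi/d;j^*M)$. For a small category $\mathcal{E}$, an $R\mathcal{E}$-module is a functor $A:\mathcal{E}\to R\text{-Mod}$ (these form an abelian category with objectwise exactness), and $H^p(\mathcal{E};A):=\operatorname{Ext}^p_{R\mathcal{E}}(\underline{R},A)$, where $\underline{R}$ is the constant functor with value $R$. *)

(* Defs.v *)
From HB Require Import structures.
From mathcomp Require Import all_boot all_order all_algebra.
From mathcomp Require Import boolp.
From mathcomp Require Import ring_quotient zify.

Set Implicit Arguments.
Unset Strict Implicit.
Unset Printing Implicit Defensive.

Import GRing.Theory.
Local Open Scope ring_scope.

Section Modules.
Variable R : comPzRingType.
Implicit Types U V W : lmodType R.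

Definition mk_linear U V (f : U -> V) (fL : linear f) : {linear U -> V} :=
  HB.pack f (GRing.isLinear.Build R U V *:%R f fL).

Definition prodm (I : Type) (V : I -> lmodType R) : Type := forall i, V i.

Section Product.
Variables (I : Type) (V : I -> lmodType R).
Implicit Types f g h : prodm V.

HB.instance Definition _ := Choice.copy (prodm V) (forall i, V i).

Definition prodm_zero : prodm V := fun=> 0.
Definition prodm_opp f : prodm V := fun i => - f i.
Definition prodm_add f g : prodm V := fun i => f i + g i.
Definition prodm_scale (c : R) f : prodm V := fun i => c *: f i.

Lemma prodm_addA : associative prodm_add.
Proof. by move=> f g h; apply: functional_extensionality_dep => i; exact: addrA. Qed.
Lemma prodm_addC : commutative prodm_add.
Proof. by move=> f g; apply: functional_extensionality_dep => i; exact: addrC. Qed.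
Lemma prodm_add0 : left_id prodm_zero prodm_add.
Proof. by move=> f; apply: functional_extensionality_dep => i; exact: add0r. Qed.
Lemma prodm_addN : left_inverse prodm_zero prodm_opp prodm_add.
Proof. by move=> f; apply: functional_extensionality_dep => i; exact: addNr. Qed.

HB.instance Definition _ :=
  GRing.isZmodule.Build (prodm V) prodm_addA prodm_addC prodm_add0 prodm_addN.

Lemma prodm_scaleA a b f : prodm_scale a (prodm_scale b f) = prodm_scale (a * b) f.
Proof. by apply: functional_extensionality_dep => i; exact: scalerA. Qed.
Lemma prodm_scale1 : left_id 1 prodm_scale.
Proof. by move=> f; apply: functional_extensionality_dep => i; exact: scale1r. Qed.
Lemma prodm_scaleDr : right_distributive prodm_scale +%R.
Proof. by move=> a f g; apply: functional_extensionality_dep => i; exact: scalerDr. Qed.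
Lemma prodm_scaleDl f : {morph prodm_scale^~ f : a b / a + b}.
Proof. by move=> a b; apply: functional_extensionality_dep => i; exact: scalerDl. Qed.

HB.instance Definition _ := GRing.Zmodule_isLmodule.Build R (prodm V)
  prodm_scaleA prodm_scale1 prodm_scaleDr prodm_scaleDl.

End Product.

Definition subm V (S : submodClosed V) : Type := {x : V | x \in S}.

Section Submodule.
Variables (V : lmodType R) (S : submodClosed V).
HB.instance Definition _ := SubChoice.on (subm S).
HB.instance Definition _ := [SubChoice_isSubLmodule of subm S by <:].
End Submodule.

Section Quotient.
Variables (V : lmodType R) (B : submodClosed V).
Implicit Types u v : V.

Lemma submod_zmod : zmod_closed (B : {pred V}).
Proof. exact: GRing.submod_closedB (submodClosedP B). Qed.
Definition zmod_of : zmodClosed V :=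
  HB.pack (B : {pred V}) (GRing.isZmodClosed.Build V (B : {pred V}) submod_zmod).

Definition quotm : Type := Quotient.quot zmod_of.
HB.instance Definition _ := GRing.Zmodule.on quotm.

Definition proj_fun v : quotm := (\pi_(Quotient.quot zmod_of) v)%qT.

Lemma proj_eqE u v : (proj_fun u = proj_fun v) <-> (u - v \in B).
Proof.
have -> : (u - v \in B) = (u - v \in zmod_of) by [].
by rewrite Quotient.idealrBE; split=> [uv|/eqP//]; apply/eqP.
Qed.

Lemma proj_funD u v : proj_fun (u + v) = proj_fun u + proj_fun v.
Proof. by rewrite /proj_fun raddfD. Qed.

Lemma proj_surj (x : quotm) : exists v, proj_fun v = x.
Proof. by exists (repr x); rewrite /proj_fun reprK. Qed.

Definition quotm_scale (a : R) (x : quotm) : quotm := proj_fun (a *: repr x).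

Lemma quotm_scale_proj a v : quotm_scale a (proj_fun v) = proj_fun (a *: v).
Proof.
apply/proj_eqE; rewrite -scalerBr rpredZ//.
by apply/proj_eqE; rewrite {1}/proj_fun reprK.
Qed.

Lemma quotm_scaleA a b x : quotm_scale a (quotm_scale b x) = quotm_scale (a * b) x.
Proof. by case: (proj_surj x) => v <-; rewrite !quotm_scale_proj scalerA. Qed.
Lemma quotm_scale1 : left_id 1 quotm_scale.
Proof. by move=> x; case: (proj_surj x) => v <-; rewrite quotm_scale_proj scale1r. Qed.
Lemma quotm_scaleDr : right_distributive quotm_scale +%R.
Proof.
move=> a x y; case: (proj_surj x) => v <-; case: (proj_surj y) => u <-.
by rewrite -proj_funD !quotm_scale_proj scalerDr proj_funD.
Qed.
Lemma quotm_scaleDl x : {morph quotm_scale^~ x : a b / a + b}.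
Proof.
by move=> a b; case: (proj_surj x) => v <-; rewrite !quotm_scale_proj scalerDl proj_funD.
Qed.

HB.instance Definition _ := GRing.Zmodule_isLmodule.Build R quotm
  quotm_scaleA quotm_scale1 quotm_scaleDr quotm_scaleDl.

Lemma proj_fun_linear : linear proj_fun.
Proof. by move=> a u v; rewrite proj_funD -quotm_scale_proj. Qed.

Definition projm : {linear V -> quotm} := mk_linear proj_fun_linear.

Lemma projm_eqE u v : (projm u = projm v) <-> (u - v \in B).
Proof. exact: proj_eqE. Qed.

Lemma projm_surj (x : quotm) : exists v, projm v = x.
Proof. exact: proj_surj. Qed.

End Quotient.

Section PropSubmodule.
Variables (V : lmodType R) (P : V -> Prop).
Hypothesis P0 : P 0.
Hypothesis PL : forall a u v, P u -> P v -> P (a *: u + v).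

Definition prop_pred : {pred V} := fun v => `[< P v >].

Lemma prop_submod : submod_closed prop_pred.
Proof. by split=> [|a u v /asboolP Pu /asboolP Pv]; apply/asboolP; [|exact: PL]. Qed.

Definition submod_of : submodClosed V :=
  HB.pack prop_pred (GRing.isSubmodClosed.Build R V prop_pred prop_submod).

Lemma submod_ofP v : (v \in submod_of) <-> P v.
Proof. by split=> /asboolP. Qed.

End PropSubmodule.

(* Z / (Z n B). *)
Section Subquotient.
Variables (V : lmodType R) (Z B : submodClosed V).

Lemma restr0 : val (0 : subm Z) \in B.
Proof. by rewrite raddf0 rpred0. Qed.
Lemma restrL a (u v : subm Z) :
  val u \in B -> val v \in B -> val (a *: u + v) \in B.
Proof. by move=> uB vB; rewrite linearP rpredD// rpredZ. Qed.

Definition subquot : lmodType R := quotm (submod_of restr0 restrL).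

End Subquotient.

End Modules.

Section Complexes.
Variable R : comPzRingType.

Section SubquotientMap.
Variables (V W : lmodType R) (Z B : submodClosed V) (Z' B' : submodClosed W).

Definition subclass (z : subm Z) : subquot Z B := projm _ z.

Lemma subclass_eq z z' : (subclass z = subclass z') <-> (val z - val z' \in B).
Proof.
split=> [/projm_eqE/submod_ofP|zz']; first by rewrite raddfB.
by apply/projm_eqE/submod_ofP; rewrite raddfB.
Qed.

Lemma subclass_surj (x : subquot Z B) : exists z, subclass z = x.
Proof. exact: projm_surj. Qed.

Lemma subclass_linear : linear subclass.
Proof. exact: linearP. Qed.

Variable f : {linear V -> W}.
Hypothesis fZ : forall z, z \in Z -> f z \in Z'.
Hypothesis fB : forall z, z \in B -> f z \in B'.

Definition subm_map (z : subm Z) : subm Z' := exist _ (f (val z)) (fZ (valP z)).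

End SubquotientMap.

Section SubquotientMap2.
Variables (V W : lmodType R) (Z B : submodClosed V) (Z' B' : submodClosed W).
Variable f : {linear V -> W}.
Hypothesis fZ : forall z, z \in Z -> f z \in Z'.
Hypothesis fB : forall z, z \in B -> f z \in B'.

Definition subq_fun (x : subquot Z B) : subquot Z' B' :=
  subclass B' (subm_map fZ (repr x)).

Lemma subq_fun_class z : subq_fun (subclass B z) = subclass B' (subm_map fZ z).
Proof.
apply/subclass_eq; rewrite /= -raddfB; apply: fB.
by apply/subclass_eq; rewrite /subclass /= /proj_fun reprK.
Qed.

Lemma subq_fun_linear : linear subq_fun.
Proof.
move=> a x y; case: (subclass_surj x) => u <-; case: (subclass_surj y) => v <-.
rewrite -subclass_linear !subq_fun_class -subclass_linear.
by congr subclass; apply: val_inj; rewrite /= !linearP.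
Qed.

Definition subq_map : {linear subquot Z B -> subquot Z' B'} :=
  mk_linear subq_fun_linear.

Lemma subq_map_class z : subq_map (subclass B z) = subclass B' (subm_map fZ z).
Proof. exact: subq_fun_class. Qed.

End SubquotientMap2.

Record complex := Complex {
  cob :> nat -> lmodType R;
  cd : forall n, {linear cob n -> cob n.+1};
  cdd : forall n (x : cob n), cd n.+1 (cd n x) = 0 }.

Section Cohomology.
Variable C : complex.

Definition is_cocycle n (x : C n) : Prop := cd C n x = 0.

Definition is_coboundary n : C n -> Prop :=
  match n with
  | 0 => fun x => x = 0
  | m.+1 => fun x => exists y : C m, cd C m y = x
  end.

Lemma cocycle0 n : @is_cocycle n 0.
Proof. exact: raddf0. Qed.
Lemma cocycleL n a (u v : C n) :
  is_cocycle u -> is_cocycle v -> is_cocycle (a *: u + v).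
Proof. by rewrite /is_cocycle linearP => -> ->; rewrite scaler0 addr0. Qed.
Lemma coboundary0 n : @is_coboundary n 0.
Proof. by case: n => //= n; exists 0; exact: raddf0. Qed.
Lemma coboundaryL n a (u v : C n) :
  is_coboundary u -> is_coboundary v -> is_coboundary (a *: u + v).
Proof.
case: n u v => /= [u v -> ->|n u v [x <-] [y <-]]; first by rewrite scaler0 addr0.
by exists (a *: x + y); rewrite linearP.
Qed.

Definition cocycles n : submodClosed (C n) :=
  submod_of (@cocycle0 n) (@cocycleL n).
Definition coboundaries n : submodClosed (C n) :=
  submod_of (@coboundary0 n) (@coboundaryL n).
Definition cohomology n : lmodType R := subquot (cocycles n) (coboundaries n).

End Cohomology.

Record cmap (C D : complex) := CMap {
  cmob :> forall n, {linear C n -> D n};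
  cmd : forall n x, cmob n.+1 (cd C n x) = cd D n (cmob n x) }.

Section CohomologyMap.
Variables (C D : complex) (f : cmap C D) (n : nat).

Lemma cmap_cocycle z : z \in cocycles C n -> f n z \in cocycles D n.
Proof. by move=> /submod_ofP zC; apply/submod_ofP; rewrite /is_cocycle -cmd zC raddf0. Qed.
Lemma cmap_coboundary z : z \in coboundaries C n -> f n z \in coboundaries D n.
Proof.
move=> /submod_ofP zC; apply/submod_ofP; case: n z zC => /= [z ->|m z [y <-]].
  exact: raddf0.
by exists (f m y); rewrite cmd.
Qed.

Definition cohomology_map : {linear cohomology C n -> cohomology D n} :=
  subq_map cmap_cocycle cmap_coboundary.

End CohomologyMap.

Lemma cohomology_map_id (C : complex) (f : cmap C C) n :
  (forall m x, f m x = x) -> forall x, cohomology_map f n x = x.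
Proof.
move=> fE x; case: (subclass_surj x) => z <-; rewrite subq_map_class.
by congr subclass; apply: val_inj; exact: fE.
Qed.

Lemma cohomology_map_comp (C D E : complex) (f : cmap C D) (g : cmap D E)
    (h : cmap C E) n :
  (forall m x, h m x = g m (f m x)) ->
  forall x, cohomology_map h n x = cohomology_map g n (cohomology_map f n x).
Proof.
move=> hE x; case: (subclass_surj x) => z <-.
rewrite [cohomology_map f _ _]subq_map_class [cohomology_map g _ _]subq_map_class.
rewrite [LHS]subq_map_class.
by congr subclass; apply: val_inj; exact: hE.
Qed.

End Complexes.

Lemma sig_eq (T : Type) (P : T -> Prop) (u v : {x | P x}) :
  sval u = sval v -> u = v.
Proof. by case: u v => [x p] [y q] /= xy; exact: eq_exist. Qed.

(* The objects and the morphisms of a category form types in (at most) the      *)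
(* universe of the carriers of R-modules: categories are small.                 *)
Record category := Category {
  obj :> Type;
  hom : obj -> obj -> Type;
  idm : forall a, hom a a;
  mcomp : forall a b c, hom b c -> hom a b -> hom a c;
  mcomp1m : forall a b (f : hom a b), mcomp (idm b) f = f;
  mcompm1 : forall a b (f : hom a b), mcomp f (idm a) = f;
  mcompA : forall a b c d (h : hom c d) (g : hom b c) (f : hom a b),
    mcomp h (mcomp g f) = mcomp (mcomp h g) f }.

Arguments idm {C} a : rename.
Notation "g \oc f" := (mcomp g f) (at level 40, left associativity).

Definition opcat (C : category) : category :=
  @Category C (fun a b => hom b a) (fun a => idm a)
    (fun a b c g f => f \oc g)
    (fun a b f => mcompm1 f) (fun a b f => mcomp1m f)
    (fun a b c d h g f => esym (mcompA f g h)).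

Record functor (C D : category) := Functor {
  fob :> C -> D;
  fhom : forall a b, hom a b -> hom (fob a) (fob b);
  fhom1 : forall a, fhom (idm a) = idm (fob a);
  fhomM : forall a b c (g : hom b c) (f : hom a b),
    fhom (g \oc f) = fhom g \oc fhom f }.

Definition idfunctor (C : category) : functor C C :=
  @Functor C C id (fun _ _ f => f) (fun=> erefl) (fun _ _ _ _ _ => erefl).

Section FunctorComp.
Variables (A B C : category) (G : functor B C) (F : functor A B).
Lemma fcomp1 a : fhom G (fhom F (idm a)) = idm (G (F a)).
Proof. by rewrite !fhom1. Qed.
Lemma fcompM a b c (g : hom b c) (f : @hom A a b) :
  fhom G (fhom F (g \oc f)) = fhom G (fhom F g) \oc fhom G (fhom F f).
Proof. by rewrite !fhomM. Qed.
Definition fcomp : functor A C :=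
  @Functor A C (fun a => G (F a)) (fun _ _ f => fhom G (fhom F f)) fcomp1 fcompM.
End FunctorComp.

Definition eqhom (C : category) (a b : C) (e : a = b) : hom a b :=
  ecast x (hom a x) e (idm a).

Lemma eqhom_id (C : category) (a : C) (e : a = a) : eqhom e = idm a.
Proof. by rewrite (Prop_irrelevance e erefl). Qed.

Lemma eqhom_trans (C : category) (a b c : C) (e : a = b) (e' : b = c) :
  eqhom e' \oc eqhom e = eqhom (etrans e e').
Proof. by case: c / e'; rewrite mcomp1m. Qed.

Lemma fhom_eqhom (C D : category) (F : functor C D) (a b : C) (e : a = b) :
  fhom F (eqhom e) = eqhom (congr1 F e).
Proof. by case: b / e; rewrite /= fhom1. Qed.

Definition fob_eq (C D : category) (F G : functor C D) (e : F = G) (a : C) :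
  F a = G a := congr1 (fun H : functor C D => H a) e.

Lemma eqhom_natural (C D : category) (F G : functor C D) (e : F = G)
    (a b : C) (f : hom a b) :
  fhom G f \oc eqhom (fob_eq e a) = eqhom (fob_eq e b) \oc fhom F f.
Proof. by case: G / e; rewrite /= mcomp1m mcompm1. Qed.

Lemma functor_ext (C D : category) (F G : functor C D) (e : forall a, F a = G a) :
  (forall a b (f : hom a b), fhom G f \oc eqhom (e a) = eqhom (e b) \oc fhom F f) ->
  F = G.
Proof.
case: F G e => [o m i c] [o' m' i' c'] /= e.
have eo : o = o' by apply: functional_extensionality_dep.
case: o' / eo m' i' c' e => m' i' c' e em.
have emm : m = m'.
  apply: functional_extensionality_dep => a; apply: functional_extensionality_dep => b.
  apply: functional_extensionality_dep => f.
  by have := em _ _ f; rewrite !eqhom_id mcomp1m mcompm1.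
case: m' / emm i' c' {em} => i' c'.
by rewrite (Prop_irrelevance i i') (Prop_irrelevance c c').
Qed.

Lemma functor_strict (C D : category) (o : C -> D) m i c i' c' :
  @Functor C D o m i c = @Functor C D o m i' c'.
Proof. by rewrite (Prop_irrelevance i i') (Prop_irrelevance c c'). Qed.

Lemma fcompA (A B C D : category) (H : functor C D) (G : functor B C)
    (F : functor A B) : fcomp H (fcomp G F) = fcomp (fcomp H G) F.
Proof. exact: functor_strict. Qed.

Lemma fcomp_id (A B : category) (F : functor A B) : fcomp F (idfunctor A) = F.
Proof. by case: F => *; exact: functor_strict. Qed.

Lemma id_fcomp (A B : category) (F : functor A B) : fcomp (idfunctor B) F = F.
Proof. by case: F => *; exact: functor_strict. Qed.

(* A functor to the category of small categories. *)
Record cat_functor (D : category) := CatFunctor {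
  cfob :> D -> category;
  cfhom : forall a b, hom a b -> functor (cfob a) (cfob b);
  cfhom1 : forall a, cfhom (idm a) = idfunctor (cfob a);
  cfhomM : forall a b c (g : hom b c) (f : hom a b),
    cfhom (g \oc f) = fcomp (cfhom g) (cfhom f) }.

Section Grothendieck.
Variables (D : category) (F : cat_functor D).

Definition gobj : Type := {d : D & F d}.

Definition ghom (X Y : gobj) : Type :=
  {alpha : hom (projT1 X) (projT1 Y) &
   hom (cfhom F alpha (projT2 X)) (projT2 Y)}.

(* Functoriality of F is an equality of functors, hence the eqhom's below:      *)
(* the map F(id)(x) -> x of the identity, and the F(g f)(x) -> F(g)(F(f)(x))    *)
(* that precedes g_2 o F(g_1)(f_2) in the composite.                            *)
Definition gid (X : gobj) : ghom X X :=
  existT _ (idm (projT1 X)) (eqhom (fob_eq (cfhom1 F _) (projT2 X))).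

Definition gcomp (X Y Z : gobj) (g : ghom Y Z) (f : ghom X Y) : ghom X Z :=
  existT _ (projT1 g \oc projT1 f)
    (projT2 g \oc (fhom (cfhom F (projT1 g)) (projT2 f) \oc
       eqhom (fob_eq (cfhomM F (projT1 g) (projT1 f)) (projT2 X)))).

Lemma ghom_eq (X Y : gobj) (u v : ghom X Y) (e : projT1 u = projT1 v) :
  projT2 u = projT2 v \oc
    eqhom (fob_eq (congr1 (fun a => cfhom F a) e) (projT2 X)) -> u = v.
Proof.
case: u v e => [a g] [b h] /= e; case: b / e h => h /=.
by rewrite mcompm1 => ->.
Qed.

Lemma gcomp1m X Y (f : ghom X Y) : gcomp (gid Y) f = f.
Proof.
apply: (@ghom_eq _ _ (gcomp (gid Y) f) f (mcomp1m (projT1 f))) => /=.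
rewrite mcompA -(eqhom_natural (cfhom1 F (projT1 Y)) (projT2 f)).
by rewrite -mcompA eqhom_trans; congr mcomp; congr eqhom; exact: Prop_irrelevance.
Qed.

Lemma gcompm1 X Y (f : ghom X Y) : gcomp f (gid X) = f.
Proof.
apply: (@ghom_eq _ _ (gcomp f (gid X)) f (mcompm1 (projT1 f))) => /=.
by rewrite fhom_eqhom eqhom_trans; congr mcomp; congr eqhom; exact: Prop_irrelevance.
Qed.

Lemma gcompA X Y Z T (h : ghom Z T) (g : ghom Y Z) (f : ghom X Y) :
  gcomp h (gcomp g f) = gcomp (gcomp h g) f.
Proof.
apply: (@ghom_eq _ _ (gcomp h (gcomp g f)) (gcomp (gcomp h g) f)
         (mcompA (projT1 h) (projT1 g) (projT1 f))) => /=.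
rewrite !fhomM fhom_eqhom -!mcompA.
congr mcomp; congr mcomp.
rewrite [in RHS]mcompA [eqhom _ \oc fhom _ _]
  (esym (eqhom_natural (cfhomM F (projT1 h) (projT1 g)) (projT2 f))) /=.
rewrite -!mcompA !eqhom_trans; congr mcomp.
by congr eqhom; exact: Prop_irrelevance.
Qed.

Definition grothendieck : category := Category gcomp1m gcompm1 gcompA.

Definition gproj : functor grothendieck D :=
  @Functor grothendieck D (fun X => projT1 X) (fun _ _ f => projT1 f)
    (fun=> erefl) (fun _ _ _ _ _ => erefl).

End Grothendieck.

Section Comma.
Variables (C D : category) (pi : functor C D).

Section Over.
Variable d : D.

Definition comma_obj : Type := {x : C & hom (pi x) d}.
Definition comma_hom (X Y : comma_obj) : Type :=
  {f : hom (projT1 X) (projT1 Y) | projT2 Y \oc fhom pi f = projT2 X}.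

Lemma comma_id_subproof (X : comma_obj) :
  projT2 X \oc fhom pi (idm (projT1 X)) = projT2 X.
Proof. by rewrite fhom1 mcompm1. Qed.
Lemma comma_comp_subproof (X Y Z : comma_obj) (g : comma_hom Y Z) (f : comma_hom X Y) :
  projT2 Z \oc fhom pi (sval g \oc sval f) = projT2 X.
Proof. by rewrite fhomM mcompA (svalP g) (svalP f). Qed.

Definition comma_id X : comma_hom X X := exist _ _ (comma_id_subproof X).
Definition comma_comp X Y Z (g : comma_hom Y Z) (f : comma_hom X Y) :
  comma_hom X Z := exist _ _ (comma_comp_subproof g f).

Lemma comma_hom_eq X Y (f g : comma_hom X Y) : sval f = sval g -> f = g.
Proof. exact: sig_eq. Qed.

Definition comma : category := @Category comma_obj comma_hom comma_id comma_comp
  (fun _ _ f => @comma_hom_eq _ _ (comma_comp (comma_id _) f) f (mcomp1m (sval f)))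
  (fun _ _ f => @comma_hom_eq _ _ (comma_comp f (comma_id _)) f (mcompm1 (sval f)))
  (fun _ _ _ _ h g f => @comma_hom_eq _ _
       (comma_comp h (comma_comp g f)) (comma_comp (comma_comp h g) f)
       (mcompA (sval h) (sval g) (sval f))).

Definition comma_proj : functor comma C :=
  @Functor comma C (fun X => projT1 X) (fun _ _ f => sval f)
    (fun=> erefl) (fun _ _ _ _ _ => erefl).

End Over.

Section Push.
Variables (d d' : D) (beta : hom d d').

Definition push_obj (X : comma d) : comma d' :=
  existT _ (projT1 X) (beta \oc projT2 X).
Lemma push_subproof (X Y : comma d) (f : hom X Y) :
  projT2 (push_obj Y) \oc fhom pi (sval f) = projT2 (push_obj X).
Proof. by rewrite -mcompA (svalP f). Qed.
Definition push_hom (X Y : comma d) (f : hom X Y) : hom (push_obj X) (push_obj Y) :=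
  exist _ (sval f) (push_subproof f).

Lemma push_hom1 (X : comma d) : push_hom (idm X) = idm (push_obj X :> comma d').
Proof. exact: comma_hom_eq. Qed.
Lemma push_homM (X Y Z : comma d) (g : hom Y Z) (f : hom X Y) :
  push_hom (g \oc f) = push_hom g \oc push_hom f.
Proof. exact: comma_hom_eq. Qed.

Definition comma_push : functor (comma d) (comma d') :=
  @Functor (comma d) (comma d') push_obj push_hom push_hom1 push_homM.

Lemma comma_proj_push : fcomp (comma_proj d') comma_push = comma_proj d.
Proof. exact: functor_strict. Qed.

End Push.

Lemma sval_eqhom d (X Y : comma d) (e : X = Y) (e' : projT1 X = projT1 Y) :
  sval (eqhom e) = eqhom e'.
Proof. by case: Y / e e' => e'; rewrite (eqhom_id e'). Qed.

Lemma comma_push1 d : comma_push (idm d) = idfunctor (comma d).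
Proof.
have e X : comma_push (idm d) X = idfunctor (comma d) X.
  case: X => x m; exact: (congr1 (existT (fun x => hom (pi x) d) x) (mcomp1m m)).
apply: (functor_ext (e := e)) => X Y f; apply: comma_hom_eq => /=.
rewrite (sval_eqhom (e X) erefl) (sval_eqhom (e Y) erefl).
by rewrite mcompm1 mcomp1m.
Qed.

Lemma comma_pushM a b c (g : hom b c) (f : hom a b) :
  comma_push (g \oc f) = fcomp (comma_push g) (comma_push f).
Proof.
have e X : comma_push (g \oc f) X = fcomp (comma_push g) (comma_push f) X.
  case: X => x m.
  exact: (congr1 (existT (fun x => hom (pi x) c) x) (esym (mcompA g f m))).
apply: (functor_ext (e := e)) => X Y h; apply: comma_hom_eq => /=.
rewrite (sval_eqhom (e X) erefl) (sval_eqhom (e Y) erefl).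
by rewrite mcompm1 mcomp1m.
Qed.

End Comma.

Definition nondecreasing_map (m n : nat) (f : 'I_m.+1 -> 'I_n.+1) : Prop :=
  forall i j : 'I_m.+1, (i <= j)%N -> (f i <= f j)%N.

Definition simplex_hom (m n : nat) : Type := {f : 'I_m.+1 -> 'I_n.+1 | nondecreasing_map f}.

Lemma simplex_hom_eq m n (f g : simplex_hom m n) : sval f = sval g -> f = g.
Proof. exact: sig_eq. Qed.

Definition simplex_id n : simplex_hom n n := exist (@nondecreasing_map n n) id (fun _ _ ij => ij).
Definition simplex_comp l m n (g : simplex_hom m n) (f : simplex_hom l m) :
  simplex_hom l n :=
  exist (@nondecreasing_map l n) (sval g \o sval f) (fun i j ij => svalP g _ _ (svalP f i j ij)).

Lemma simplex_comp1m m n (f : simplex_hom m n) : simplex_comp (simplex_id n) f = f.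
Proof. exact: simplex_hom_eq. Qed.
Lemma simplex_compm1 m n (f : simplex_hom m n) : simplex_comp f (simplex_id m) = f.
Proof. exact: simplex_hom_eq. Qed.
Lemma simplex_compA k l m n (h : simplex_hom m n) (g : simplex_hom l m)
    (f : simplex_hom k l) :
  simplex_comp h (simplex_comp g f) = simplex_comp (simplex_comp h g) f.
Proof. exact: simplex_hom_eq. Qed.

(* The object n stands for [n] = {0 < ... < n}. *)
Definition Delta : category := @Category nat simplex_hom simplex_id simplex_comp
  simplex_comp1m simplex_compm1 simplex_compA.

Record sset := SSet {
  simp :> nat -> Type;
  sact : forall m n : Delta, hom m n -> simp n -> simp m;
  sact1 : forall (n : Delta) (s : simp n), sact (idm n) s = s;
  sactM : forall (l m n : Delta) (g : hom m n) (f : hom l m) (s : simp n),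
    sact (g \oc f) s = sact f (sact g s) }.

Record smap (X Y : sset) := SMap {
  smob :> forall n, X n -> Y n;
  sm_act : forall (m n : Delta) (f : hom m n) (s : X n),
    smob (sact f s) = sact f (smob s) }.

Definition ordinal_cat (n : nat) : category :=
  @Category 'I_n.+1 (fun i j => (i <= j)%N) (fun i => leqnn i)
    (fun i j k jk ij => leq_trans ij jk)
    (fun _ _ _ => bool_irrelevance _ _) (fun _ _ _ => bool_irrelevance _ _)
    (fun _ _ _ _ _ _ _ => bool_irrelevance _ _).

Definition ordinal_functor (m n : Delta) (f : hom m n) :
  functor (ordinal_cat m) (ordinal_cat n) :=
  @Functor (ordinal_cat m) (ordinal_cat n) (sval f)
    (fun i j ij => svalP f i j ij)
    (fun _ => bool_irrelevance _ _) (fun _ _ _ _ _ => bool_irrelevance _ _).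

Section Nerve.
Variable C : category.

Definition nerve_simp (n : nat) : Type := functor (ordinal_cat n) C.
Definition nerve_act (m n : Delta) (f : hom m n) (s : nerve_simp n) : nerve_simp m :=
  fcomp s (ordinal_functor f).

Lemma nerve_act1 (n : Delta) s : nerve_act (idm n) s = s.
Proof.
apply: (@functor_ext _ _ (nerve_act (idm n) s) s (fun=> erefl)) => i j ij /=.
by rewrite mcompm1 mcomp1m; congr fhom; exact: bool_irrelevance.
Qed.
Lemma nerve_actM (l m n : Delta) (g : hom m n) (f : hom l m) s :
  nerve_act (g \oc f) s = nerve_act f (nerve_act g s).
Proof.
apply: (@functor_ext _ _ (nerve_act (g \oc f) s) (nerve_act f (nerve_act g s))
  (fun=> erefl)) => i j ij /=.
by rewrite mcompm1 mcomp1m; congr fhom; exact: bool_irrelevance.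
Qed.

Definition nerve : sset := SSet nerve_act1 nerve_actM.

End Nerve.

Definition nerve_map (A B : category) (F : functor A B) : smap (nerve A) (nerve B) :=
  @SMap (nerve A) (nerve B) (fun n s => fcomp F s)
    (fun m n f s => fcompA F s (ordinal_functor f)).

Section Simplices.
Variable X : sset.

Definition simplices_obj : Type := {n : nat & X n}.
Definition simplices_hom (t s : simplices_obj) : Type :=
  {f : @hom Delta (projT1 t) (projT1 s) | sact f (projT2 s) = projT2 t}.

Lemma simplices_comp_subproof (r s t : simplices_obj)
    (g : simplices_hom s t) (f : simplices_hom r s) :
  sact (sval g \oc sval f) (projT2 t) = projT2 r.
Proof. by rewrite sactM (svalP g) (svalP f). Qed.

Definition simplices_id s : simplices_hom s s := exist _ (idm _) (sact1 (projT2 s)).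
Definition simplices_comp r s t (g : simplices_hom s t) (f : simplices_hom r s) :
  simplices_hom r t := exist _ _ (simplices_comp_subproof g f).

Lemma simplices_hom_eq s t (f g : simplices_hom s t) : sval f = sval g -> f = g.
Proof. exact: sig_eq. Qed.

Definition simplices : category :=
  @Category simplices_obj simplices_hom simplices_id simplices_comp
    (fun _ _ f => @simplices_hom_eq _ _ (simplices_comp (simplices_id _) f) f (mcomp1m (sval f)))
    (fun _ _ f => @simplices_hom_eq _ _ (simplices_comp f (simplices_id _)) f (mcompm1 (sval f)))
    (fun _ _ _ _ h g f => @simplices_hom_eq _ _
       (simplices_comp h (simplices_comp g f)) (simplices_comp (simplices_comp h g) f)
       (mcompA (sval h) (sval g) (sval f))).

(* The morphism f : (m, f^* s) -> (n, s). *)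
Definition act_hom (m n : Delta) (f : hom m n) (s : X n) :
  @hom simplices (existT _ m (sact f s)) (existT _ n s) := exist _ f erefl.

(* The identity of (n, t), seen as a morphism (n, t) -> (n, s) when t = s. *)
Lemma simplex_eq_subproof n (t s : X n) (e : t = s) : sact (idm (n : Delta)) s = t.
Proof. by rewrite e sact1. Qed.
Definition simplex_eq n (t s : X n) (e : t = s) :
  @hom simplices (existT _ n t) (existT _ n s) :=
  exist _ (idm (n : Delta)) (simplex_eq_subproof e).

End Simplices.

Section SimplicesMap.
Variables (X Y : sset) (phi : smap X Y).

Lemma simplices_map_subproof (s t : simplices X) (f : hom s t) :
  sact (sval f) (phi _ (projT2 t)) = phi _ (projT2 s).
Proof. by rewrite -sm_act (svalP f). Qed.

Definition simplices_map_hom (s t : simplices X) (f : hom s t) :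
  @hom (simplices Y) (existT _ (projT1 s) (phi _ (projT2 s)))
                     (existT _ (projT1 t) (phi _ (projT2 t))) :=
  exist _ (sval f) (simplices_map_subproof f).
Lemma simplices_map1 (s : simplices X) : simplices_map_hom (idm s) = idm _.
Proof. exact: simplices_hom_eq. Qed.
Lemma simplices_mapM (r s t : simplices X) (g : hom s t) (f : hom r s) :
  simplices_map_hom (g \oc f) = simplices_map_hom g \oc simplices_map_hom f.
Proof. exact: simplices_hom_eq. Qed.

Definition simplices_map : functor (simplices X) (simplices Y) :=
  @Functor (simplices X) (simplices Y)
    (fun s => existT _ (projT1 s) (phi _ (projT2 s)))
    simplices_map_hom simplices_map1 simplices_mapM.

End SimplicesMap.

Section ModFunctors.
Variable R : comPzRingType.

(* A functor E -> R-Mod, also called an RE-module. *)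
Record modfun (E : category) := ModFun {
  mob :> E -> lmodType R;
  mhom : forall a b, hom a b -> {linear mob a -> mob b};
  mhom1 : forall a (x : mob a), mhom (idm a) x = x;
  mhomM : forall a b c (g : hom b c) (f : hom a b) (x : mob a),
    mhom (g \oc f) x = mhom g (mhom f x) }.

Definition const_modfun (E : category) (V : lmodType R) : modfun E :=
  @ModFun E (fun=> V) (fun _ _ _ => idfun) (fun _ _ => erefl)
    (fun _ _ _ _ _ _ => erefl).

Section Pullback.
Variables (A B : category) (F : functor A B) (M : modfun B).
Lemma mod_pull1 a (x : M (F a)) : mhom M (fhom F (idm a)) x = x.
Proof. by rewrite fhom1 mhom1. Qed.
Lemma mod_pullM a b c (g : hom b c) (f : hom a b) (x : M (F a)) :
  mhom M (fhom F (g \oc f)) x = mhom M (fhom F g) (mhom M (fhom F f) x).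
Proof. by rewrite fhomM mhomM. Qed.
Definition mod_pull : modfun A :=
  @ModFun A (fun a => M (F a)) (fun _ _ f => mhom M (fhom F f)) mod_pull1 mod_pullM.
End Pullback.

Section NatTrans.
Variable E : category.

(* The R-module Hom_{RE}(A, B), as a submodule of the product of all B(e)^A(e). *)
Section Hom.
Variables A B : modfun E.

Definition nt_family : lmodType R :=
  prodm (fun e : E => (prodm (fun _ : A e => B e) : lmodType R)).

Definition natural_linear (phi : nt_family) : Prop :=
  (forall e, linear (phi e)) /\
  (forall a b (f : hom a b) (x : A a), phi b (mhom A f x) = mhom B f (phi a x)).

Lemma natural_linear0 : natural_linear 0.
Proof.
split=> [e a x y|a b f x] /=; last by rewrite raddf0.
by rewrite -[RHS]/(a *: 0 + 0 : B e) scaler0 addr0.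
Qed.
Lemma natural_linearL c (u v : nt_family) :
  natural_linear u -> natural_linear v -> natural_linear (c *: u + v).
Proof.
move=> [uL uN] [vL vN]; split=> [e a x y|a b f x].
  rewrite -[LHS]/(c *: u e (a *: x + y) + v e (a *: x + y)).
  rewrite -[RHS]/(a *: (c *: u e x + v e x) + (c *: u e y + v e y)).
  rewrite uL vL !scalerDr !scalerA [c * a]mulrC -!addrA; congr (_ + _).
  by rewrite addrCA.
rewrite -[LHS]/(c *: u b (mhom A f x) + v b (mhom A f x)) uN vN.
by rewrite -linearP.
Qed.

Definition nattrans : Type := subm (submod_of natural_linear0 natural_linearL).
HB.instance Definition _ := GRing.Lmodule.on nattrans.

Definition nt_fun (phi : nattrans) (e : E) : A e -> B e := val phi e.

Lemma nt_prop (phi : nattrans) : natural_linear (val phi).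
Proof. by have /submod_ofP := valP phi. Qed.

Definition nt (phi : nattrans) (e : E) : {linear A e -> B e} :=
  mk_linear (proj1 (nt_prop phi) e).

Lemma ntN (phi : nattrans) a b (f : hom a b) (x : A a) :
  nt phi b (mhom A f x) = mhom B f (nt phi a x).
Proof. exact: (proj2 (nt_prop phi)). Qed.

Lemma nt_eq (phi psi : nattrans) : (forall e x, nt phi e x = nt psi e x) -> phi = psi.
Proof.
move=> h; apply: val_inj; apply: functional_extensionality_dep => e.
by apply: functional_extensionality_dep => x; exact: h.
Qed.

Lemma ntP c (phi psi : nattrans) e x :
  nt (c *: phi + psi) e x = c *: nt phi e x + nt psi e x.
Proof. by []. Qed.

Lemma mk_nt_subproof (f : forall e, {linear A e -> B e})
    (fN : forall a b (g : hom a b) (x : A a), f b (mhom A g x) = mhom B g (f a x)) :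
  ((fun e x => f e x) : nt_family) \in submod_of natural_linear0 natural_linearL.
Proof. by apply/submod_ofP; split=> // e a x y; rewrite linearP. Qed.
Definition mk_nt (f : forall e, {linear A e -> B e})
    (fN : forall a b (g : hom a b) (x : A a), f b (mhom A g x) = mhom B g (f a x)) :
  nattrans := exist _ (fun e x => f e x : B e) (mk_nt_subproof fN).

End Hom.

Section Compose.
Variables (A B C : modfun E) (psi : nattrans B C) (phi : nattrans A B).
Lemma nt_comp_subproof a b (g : hom a b) (x : A a) :
  (nt psi b \o nt phi b) (mhom A g x) = mhom C g ((nt psi a \o nt phi a) x).
Proof. exact: etrans (congr1 (nt psi b) (ntN phi g x)) (ntN psi g _). Qed.
Definition nt_comp : nattrans A C :=
  @mk_nt A C (fun e => (nt psi e \o nt phi e : {linear A e -> C e})) nt_comp_subproof.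
End Compose.

End NatTrans.

Lemma lift_mono n (i : 'I_n.+2) : @nondecreasing_map n n.+1 (lift i).
Proof. by move=> j k jk; rewrite /= leq_bump2. Qed.

(* d^i : [n] -> [n + 1], the increasing map that misses i. *)
Definition coface n (i : 'I_n.+2) : @hom Delta n n.+1 :=
  exist (@nondecreasing_map n n.+1) (lift i) (lift_mono i).

Section CosimplicialComplex.
Variable A : modfun Delta.

Definition alternating_sum n (x : A n) : A n.+1 :=
  \sum_(i < n.+2) (-1) ^+ i *: mhom A (coface i) x.

Lemma alternating_sum_linear n : linear (@alternating_sum n).
Proof.
move=> a u v; rewrite /alternating_sum scaler_sumr -big_split /=.
apply: eq_bigr => i _; rewrite linearP scalerDr !scalerA.
by rewrite [_ * a]mulrC.
Qed.

Lemma alternating_sumK n (x : A n) : alternating_sum (alternating_sum x) = 0.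
Proof.
pose T (p : 'I_n.+3 * 'I_n.+2) : A n.+2 :=
  (-1) ^+ (p.1 + p.2) *: mhom A (coface p.1 \oc coface p.2) x.
have -> : alternating_sum (alternating_sum x) = \sum_p T p.
  rewrite -(pair_bigA _ (fun j i => T (j, i))) /=; apply: eq_bigr => j _.
  rewrite raddf_sum scaler_sumr; apply: eq_bigr => i _.
  by rewrite /T /= linearZ scalerA -exprD mhomM.
have unb (j : 'I_n.+3) (i : 'I_n.+2) : (unbump i j < n.+2)%N.
  rewrite /unbump; have := ltn_ord i; have := ltn_ord j.
  by case: (ltnP i j) => /=; case: (j : nat) => [|k]; rewrite ?subn0 ?subn1//=; lia.
pose s (p : 'I_n.+3 * 'I_n.+2) : 'I_n.+3 * 'I_n.+2 :=
  (lift p.1 p.2, Ordinal (unb p.1 p.2)).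
have sK : involutive s.
  move=> [j i]; rewrite /s; congr pair; apply: val_inj; rewrite /= /bump /unbump;
  have := ltn_ord i; have := ltn_ord j; lia.
have sT p : T (s p) = - T p.
  case: p => j i; have cE : coface (lift j i) \oc coface (Ordinal (unb j i)) = coface j \oc coface i.
    apply: simplex_hom_eq; apply: functional_extensionality_dep => k.
    by apply: val_inj; rewrite /= /bump /unbump; lia.
  rewrite -[LHS]/((-1) ^+ (bump j i + unbump i j) *:
    mhom A (coface (lift j i) \oc coface (Ordinal (unb j i))) x) cE -scaleNr.
  congr (_ *: _); rewrite -[RHS]mulN1r -exprS -signr_odd -[RHS]signr_odd; congr (_ ^+ _).
  by congr (nat_of_bool _); rewrite /bump /unbump /=; lia.
rewrite (bigID (fun p : 'I_n.+3 * 'I_n.+2 => p.2 < p.1)%N) /=.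
rewrite [X in _ + X](reindex_inj (inv_inj sK)) /=.
rewrite [X in _ + X](eq_bigl (fun p : 'I_n.+3 * 'I_n.+2 => p.2 < p.1)%N); last first.
  by move=> [j i]; rewrite /= /bump /unbump; lia.
rewrite -big_split big1// => p _; apply: etrans (subrr (T p)).
by congr (_ + _); exact: sT.
Qed.

Definition cosimplicial_complex : complex R :=
  @Complex R (fun n => A n) (fun n => mk_linear (@alternating_sum_linear n))
    alternating_sumK.

End CosimplicialComplex.

Section CosimplicialMap.
Variables (A B : modfun Delta) (phi : nattrans A B).
Lemma cosimplicial_cmap_subproof n (x : A n) :
  nt phi n.+1 (alternating_sum x) = alternating_sum (nt phi n x).
Proof.
rewrite linear_sum; apply: eq_bigr => i _.
by rewrite linearZ_LR; congr (_ *: _); exact: ntN.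
Qed.
Definition cosimplicial_cmap :
    cmap (cosimplicial_complex A) (cosimplicial_complex B) :=
  @CMap R (cosimplicial_complex A) (cosimplicial_complex B)
    (fun n => nt phi n) cosimplicial_cmap_subproof.
End CosimplicialMap.

Section Cochains.

Lemma mhom_transport (X Y : sset) (phi : smap X Y) (M : modfun (simplices Y))
    (n : nat) (zeta : forall s : X n, M (existT _ n (phi n s)))
    (u : simplices Y) (s t : X n) (g : hom (existT _ n (phi n s) : simplices Y) u)
    (h : hom (existT _ n (phi n t) : simplices Y) u) :
  s = t -> sval g = sval h -> mhom M g (zeta s) = mhom M h (zeta t).
Proof. by move=> st; case: t / st h => h /simplices_hom_eq ->. Qed.

Definition smap_id (X : sset) : smap X X := @SMap X X (fun _ s => s) (fun _ _ _ _ => erefl).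

Section Def.
Variables (X : sset) (M : modfun (simplices X)).

Definition cochain (n : nat) : lmodType R := prodm (fun s : X n => M (existT _ n s)).

Definition cochain_act (m n : Delta) (f : hom m n) (zeta : cochain m) : cochain n :=
  fun s => mhom M (act_hom f s) (zeta (sact f s)).

Lemma cochain_act_linear (m n : Delta) (f : hom m n) : linear (cochain_act f).
Proof.
move=> a u v; apply: functional_extensionality_dep => s.
exact: linearP.
Qed.

Lemma cochain_act1 (n : Delta) (zeta : cochain n) : cochain_act (idm n) zeta = zeta.
Proof.
apply: functional_extensionality_dep => s.
rewrite -[RHS](mhom1 (m := M)) /cochain_act.
by apply: (@mhom_transport _ _ (smap_id X)) => //; rewrite sact1.
Qed.

Lemma cochain_actM (l m n : Delta) (g : hom m n) (f : hom l m) (zeta : cochain l) :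
  cochain_act (g \oc f) zeta = cochain_act g (cochain_act f zeta).
Proof.
apply: functional_extensionality_dep => s; rewrite /cochain_act -mhomM.
by apply: (@mhom_transport _ _ (smap_id X)) => //; rewrite sactM.
Qed.

(* The cosimplicial module C(X; M). *)
Definition cochains : modfun Delta :=
  @ModFun Delta cochain (fun m n f => mk_linear (@cochain_act_linear m n f))
    cochain_act1 cochain_actM.

Definition gz_cohomology (n : nat) : lmodType R :=
  cohomology (cosimplicial_complex cochains) n.

End Def.

Section PullbackCochains.
Variables (X Y : sset) (phi : smap X Y) (M : modfun (simplices Y)).

Definition cochain_pull_fun (n : Delta) (zeta : cochains M n) :
    cochains (mod_pull (simplices_map phi) M) n :=
  fun s => zeta (phi n s).
Lemma cochain_pull_linear n : linear (@cochain_pull_fun n).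
Proof. by []. Qed.
Lemma cochain_pull_natural (m n : Delta) (f : hom m n) (zeta : cochains M m) :
  cochain_pull_fun (mhom (cochains M) f zeta) =
  mhom (cochains (mod_pull (simplices_map phi) M)) f (cochain_pull_fun zeta).
Proof.
apply: functional_extensionality_dep => s.
by apply: (@mhom_transport _ _ (smap_id Y)) => //; rewrite sm_act.
Qed.

Definition cochain_pull :
    nattrans (cochains M) (cochains (mod_pull (simplices_map phi) M)) :=
  @mk_nt Delta _ _ (fun n => mk_linear (@cochain_pull_linear n)) cochain_pull_natural.

End PullbackCochains.

Section Coefficients.
Variables (X : sset) (M N : modfun (simplices X)) (theta : nattrans M N).

Definition cochain_coef_fun (n : Delta) (zeta : cochains M n) : cochains N n :=
  fun s => nt theta _ (zeta s).
Lemma cochain_coef_linear n : linear (@cochain_coef_fun n).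
Proof.
move=> a u v; apply: functional_extensionality_dep => s.
exact: linearP.
Qed.
Lemma cochain_coef_natural (m n : Delta) (f : hom m n) (zeta : cochains M m) :
  cochain_coef_fun (mhom (cochains M) f zeta) =
  mhom (cochains N) f (cochain_coef_fun zeta).
Proof. by apply: functional_extensionality_dep => s; exact: ntN. Qed.

Definition cochain_coef : nattrans (cochains M) (cochains N) :=
  @mk_nt Delta _ _ (fun n => mk_linear (@cochain_coef_linear n)) cochain_coef_natural.

End Coefficients.

End Cochains.

Definition coef_system (C : category) := modfun (simplices (nerve C)).

Definition coef_pull (A B : category) (psi : functor A B) (M : coef_system B) :
    coef_system A :=
  mod_pull (simplices_map (nerve_map psi)) M.

Definition thomason (C : category) (M : coef_system C) (n : nat) : lmodType R :=
  gz_cohomology M n.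

(* psi^* : H^n_Th(B; M) -> H^n_Th(A; psi^* M). *)
Definition thomason_pull (A B : category) (psi : functor A B) (M : coef_system B) n :
    {linear thomason M n -> thomason (coef_pull psi M) n} :=
  cohomology_map (cosimplicial_cmap (cochain_pull (nerve_map psi) M)) n.

Definition thomason_coef (A : category) (M N : coef_system A) (theta : nattrans M N) n :
    {linear thomason M n -> thomason N n} :=
  cohomology_map (cosimplicial_cmap (cochain_coef theta)) n.

(* If psi o phi = chi, the coefficient systems phi^* psi^* M and chi^* M are     *)
(* equal; this is the identity map between them.  It is written as the action of  *)
(* M on identities of simplices, because psi o (phi o s) and chi o s are only     *)
(* provably equal.                                                               *)
Section CoefPullComp.
Variables (A B C : category) (phi : functor A B) (psi : functor B C) (chi : functor A C).
Hypothesis e : fcomp psi phi = chi.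
Variable M : coef_system C.

Lemma pull_comp_eq n (s : nerve A n) :
  nerve_map psi n (nerve_map phi n s) = nerve_map chi n s.
Proof. by rewrite -e /= fcompA. Qed.

Definition coef_pull_comp_fun (s : simplices (nerve A)) :
    {linear coef_pull phi (coef_pull psi M) s -> coef_pull chi M s} :=
  mhom M (simplex_eq (pull_comp_eq (projT2 s))).

Lemma coef_pull_comp_natural (s t : simplices (nerve A)) (f : hom s t) x :
  coef_pull_comp_fun t (mhom (coef_pull phi (coef_pull psi M)) f x) =
  mhom (coef_pull chi M) f (coef_pull_comp_fun s x).
Proof.
rewrite /= /coef_pull_comp_fun -!mhomM.
by congr (mhom M _ x); apply: simplices_hom_eq; exact: simplex_hom_eq.
Qed.

Definition coef_pull_comp : nattrans (coef_pull phi (coef_pull psi M)) (coef_pull chi M) :=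
  mk_nt coef_pull_comp_natural.

End CoefPullComp.

Section ThomasonOver.
Variables (C D : category) (pi : functor C D) (M : coef_system C) (q : nat).

Definition over_ob (d : D) : lmodType R :=
  thomason (coef_pull (comma_proj pi d) M) q.

Definition over_hom (d d' : D) (beta : hom d d') : {linear over_ob d' -> over_ob d} :=
  thomason_coef (coef_pull_comp (comma_proj_push pi beta) M) q \o
  thomason_pull (comma_push pi beta) (coef_pull (comma_proj pi d') M) q.

Definition over_cmap (d d' : D) (beta : hom d d') :=
  cosimplicial_cmap (nt_comp
    (cochain_coef (coef_pull_comp (comma_proj_push pi beta) M))
    (cochain_pull (nerve_map (comma_push pi beta)) (coef_pull (comma_proj pi d') M))).

Lemma over_homE (d d' : D) (beta : hom d d') x :
  over_hom beta x = cohomology_map (over_cmap beta) q x.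
Proof. by symmetry; apply: cohomology_map_comp. Qed.

Lemma over_hom1 (d : D) (x : over_ob d) : over_hom (idm d) x = x.
Proof.
rewrite over_homE; apply: cohomology_map_id => n zeta.
apply: functional_extensionality_dep => s; rewrite -[RHS](mhom1 (m := M)).
apply: (@mhom_transport _ _ (nerve_map (comma_proj pi d)) M n zeta) => //.
exact: etrans (congr1 (fun F => fcomp F s) (comma_push1 pi d)) (id_fcomp _).
Qed.

Lemma over_homM (a b c : D) (g : hom b c) (f : hom a b) (x : over_ob c) :
  over_hom (g \oc f) x = over_hom f (over_hom g x).
Proof.
rewrite !over_homE; apply: cohomology_map_comp => n zeta.
apply: functional_extensionality_dep => s; symmetry.
apply: etrans; first by symmetry; exact: (mhomM (m := M)).
apply: (@mhom_transport _ _ (nerve_map (comma_proj pi c)) M n zeta).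
  exact: etrans (fcompA _ _ _)
    (esym (congr1 (fun F => fcomp F s) (comma_pushM pi g f))).
exact: simplex_hom_eq.
Qed.

(* H^q_Th(pi/-; j^* M) *)
Definition thomason_over : modfun (opcat D) :=
  @ModFun (opcat D) over_ob (fun a b f => over_hom f) over_hom1
    (fun a b c g f x => over_homM f g x).

End ThomasonOver.

End ModFunctors.

Section Ext.
Variables (R : comPzRingType) (E : category).
Implicit Types A B C P : modfun R E.

Definition nt_surj A B (f : nattrans A B) : Prop :=
  forall e (y : B e), exists x, nt f e x = y.

Definition nt_exact A B C (f : nattrans A B) (g : nattrans B C) : Prop :=
  forall e (y : B e), nt g e y = 0 <-> exists x, nt f e x = y.

Definition projective P : Prop :=
  forall B C (g : nattrans B C), nt_surj g ->
  forall f : nattrans P C, exists h : nattrans P B, nt_comp g h = f.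

Record projective_resolution A := ProjectiveResolution {
  pr_ob :> nat -> modfun R E;
  pr_d : forall n, nattrans (pr_ob n.+1) (pr_ob n);
  pr_aug : nattrans (pr_ob 0) A;
  pr_projective : forall n, projective (pr_ob n);
  pr_surj : nt_surj pr_aug;
  pr_exact0 : nt_exact (pr_d 0) pr_aug;
  pr_exact : forall n, nt_exact (pr_d n.+1) (pr_d n) }.

Section HomComplex.
Variables (A B : modfun R E) (P : projective_resolution A).

Definition hom_d n (f : nattrans (P n) B) : nattrans (P n.+1) B :=
  nt_comp f (pr_d P n).
Lemma hom_d_linear n : linear (@hom_d n).
Proof. by move=> a f g; apply: nt_eq. Qed.
Lemma hom_dd n (f : nattrans (P n) B) : hom_d (hom_d f) = 0.
Proof.
apply: nt_eq => e x; rewrite -[LHS]/(nt f e (nt (pr_d P n) e (nt (pr_d P n.+1) e x))).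
have /pr_exact -> : exists y, nt (pr_d P n.+1) e y = nt (pr_d P n.+1) e x by exists x.
exact: raddf0.
Qed.

Definition hom_complex : complex R :=
  @Complex R (fun n => nattrans (P n) B) (fun n => mk_linear (@hom_d_linear n)) hom_dd.

End HomComplex.

(* Existence of projective resolutions.  The free R-module on T is the module   *)
(* of finite combinations of indicator functions of elements of T; the functor   *)
(* free_modfun A is the direct sum of copies of R[Hom(a, -)] indexed by a : E    *)
(* and x : A a, and it maps onto A.                                              *)
Section Free.
Variable T : Type.

Definition comb (s : seq (R * T)) : prodm (fun _ : T => (R^o : lmodType R)) :=
  fun t => \sum_(x <- s) x.1 * (`[< x.2 = t >] : bool)%:R.

Definition finite_comb (phi : prodm (fun _ : T => (R^o : lmodType R))) : Prop :=
  exists s, phi = comb s.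

Lemma comb_nil : comb [::] = 0.
Proof. by apply: functional_extensionality_dep => t; rewrite /comb big_nil. Qed.

Lemma comb_lin a s1 s2 :
  comb ([seq (a * x.1, x.2) | x <- s1] ++ s2) = a *: comb s1 + comb s2.
Proof.
apply: functional_extensionality_dep => t.
rewrite -[RHS]/(a * comb s1 t + comb s2 t) /comb big_cat big_map mulr_sumr /=.
by congr (_ + _); apply: eq_bigr => x _; rewrite mulrA.
Qed.

Lemma finite_comb0 : finite_comb 0.
Proof. by exists [::]; rewrite comb_nil. Qed.
Lemma finite_combL a u v : finite_comb u -> finite_comb v -> finite_comb (a *: u + v).
Proof.
by move=> [s1 ->] [s2 ->]; exists ([seq (a * x.1, x.2) | x <- s1] ++ s2); rewrite comb_lin.
Qed.

Definition freem : Type := subm (submod_of finite_comb0 finite_combL).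
HB.instance Definition _ := GRing.Lmodule.on freem.

Lemma freem_comb (u : freem) : exists s, val u = comb s.
Proof. by have /submod_ofP := valP u. Qed.

Lemma comb_mem s : comb s \in submod_of finite_comb0 finite_combL.
Proof. by apply/submod_ofP; exists s. Qed.

Definition mk_free s : freem := exist _ (comb s) (comb_mem s).
Definition gen (t : T) : freem := mk_free [:: (1, t)].

Section Lift.
Variables (V : lmodType R) (h : T -> V).

Definition ev (s : seq (R * T)) : V := \sum_(x <- s) x.1 *: h x.2.

Lemma evE (s : seq (R * T)) (l : seq {classic T}) :
  (forall x, x \in [seq (y.2 : {classic T}) | y <- s] -> x \in l) -> uniq l ->
  ev s = \sum_(t <- l) comb s t *: h t.
Proof.
move=> sl ul; rewrite /comb.
under eq_bigr do rewrite scaler_suml.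
rewrite exchange_big /= /ev.
have {}sl : all (fun y : R * T => (y.2 : {classic T}) \in l) s.
  elim: s sl => //= y s IH sl; rewrite sl ?inE ?eqxx//= IH// => x xs.
  by apply: sl; rewrite inE xs orbT.
elim: s sl => [|y s IH] /=; first by rewrite !big_nil.
move=> /andP[yl sl]; rewrite !big_cons IH//; congr (_ + _).
rewrite (bigD1_seq (y.2 : {classic T}))//= big1 => [|t /eqP ty].
  by rewrite (asboolT (erefl y.2)) mulr1 addr0.
by rewrite asboolF ?mulr0 ?scale0r// => e; apply: ty.
Qed.

Lemma ev_eq s1 s2 : comb s1 = comb s2 -> ev s1 = ev s2.
Proof.
move=> e; pose l := undup [seq (y.2 : {classic T}) | y <- s1 ++ s2].
rewrite (@evE s1 l) ?(@evE s2 l) ?undup_uniq// ?e// => x xs;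
  by rewrite mem_undup map_cat mem_cat xs ?orbT.
Qed.

Definition free_lift_fun (u : freem) : V := ev (projT1 (cid (freem_comb u))).

Lemma free_lift_mk s u : val u = comb s -> free_lift_fun u = ev s.
Proof. by move=> us; apply: ev_eq; rewrite -us; case: cid. Qed.

Lemma free_lift_linear : linear free_lift_fun.
Proof.
move=> a u v; case: (freem_comb u) => s us; case: (freem_comb v) => s' vs.
rewrite (free_lift_mk us) (free_lift_mk vs).
rewrite (@free_lift_mk ([seq (a * x.1, x.2) | x <- s] ++ s')); last first.
  by rewrite comb_lin -us -vs.
rewrite /ev big_cat big_map scaler_sumr; congr (_ + _).
by apply: eq_bigr => x _; rewrite scalerA.
Qed.

Definition free_lift : {linear freem -> V} := mk_linear free_lift_linear.

Lemma free_lift_gen t : free_lift (gen t) = h t.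
Proof. by rewrite /= (@free_lift_mk [:: (1, t)])// /ev big_seq1 scale1r. Qed.

End Lift.

Lemma free_gen (u : freem) : exists s : seq (R * T), u = \sum_(x <- s) x.1 *: gen x.2.
Proof.
case: (freem_comb u) => s us; exists s; apply: val_inj; rewrite us raddf_sum {us}.
elim: s => [|x s IH]; first by rewrite big_nil comb_nil.
rewrite big_cons -IH; apply: functional_extensionality_dep => t.
rewrite -[RHS]/(x.1 * comb [:: (1, x.2)] t + comb s t) /comb big_cons big_seq1.
by rewrite mul1r.
Qed.

Lemma free_ext (V : lmodType R) (f g : {linear freem -> V}) :
  (forall t, f (gen t) = g (gen t)) -> forall u, f u = g u.
Proof.
move=> fg u; case: (free_gen u) => s ->; rewrite !linear_sum.
by apply: eq_bigr => x _; rewrite !linearZ_LR fg.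
Qed.

End Free.

Section Cover.
Variable A : modfun R E.

Definition elements (e : E) : Type := {a : E & (A a * hom a e)%type}.
Definition elt e a (x : A a) (h : hom a e) : elements e := existT _ a (x, h).

Definition free_ob (e : E) : lmodType R := freem (elements e).
Definition free_hom (a b : E) (f : hom a b) : {linear free_ob a -> free_ob b} :=
  free_lift (fun t : elements a => gen (elt (projT2 t).1 (f \oc (projT2 t).2))).

Lemma free_hom1 a (u : free_ob a) : free_hom (idm a) u = u.
Proof.
apply: (@free_ext _ _ (free_hom (idm a)) idfun) => -[c [x h]] /=.
by rewrite [LHS]free_lift_gen /= mcomp1m.
Qed.
Lemma free_homM a b c (g : hom b c) (f : hom a b) (u : free_ob a) :
  free_hom (g \oc f) u = free_hom g (free_hom f u).
Proof.
apply: (@free_ext _ _ (free_hom (g \oc f)) (free_hom g \o free_hom f)) => -[d [x h]].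
rewrite [LHS]free_lift_gen [RHS](congr1 (free_hom g) (free_lift_gen _ _)).
by rewrite [RHS]free_lift_gen /= mcompA.
Qed.

Definition free_modfun : modfun R E := ModFun free_hom1 free_homM.

Definition cover_ob (e : E) : {linear free_modfun e -> A e} :=
  free_lift (fun t : elements e => mhom A (projT2 t).2 (projT2 t).1).

Lemma cover_natural a b (f : hom a b) (u : free_modfun a) :
  cover_ob b (mhom free_modfun f u) = mhom A f (cover_ob a u).
Proof.
apply: (@free_ext _ _ (cover_ob b \o free_hom f) (mhom A f \o cover_ob a)) => -[d [x h]].
rewrite [LHS](congr1 (cover_ob b) (free_lift_gen _ _)).
rewrite [RHS](congr1 (mhom A f) (free_lift_gen _ _)).
by rewrite [LHS]free_lift_gen /= mhomM.
Qed.

Definition free_cover : nattrans free_modfun A := mk_nt cover_natural.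

Lemma cover_surj : nt_surj free_cover.
Proof.
move=> e y; exists (gen (elt y (idm e))).
by rewrite [LHS]free_lift_gen /= mhom1.
Qed.

Lemma free_projective : projective free_modfun.
Proof.
move=> B C g gs f.
have [b bE] : exists b : forall a, A a -> B a, forall a (x : A a),
    nt g a (b a x) = nt f a (gen (elt x (idm a))).
  have H a (x : A a) : {y | nt g a y = nt f a (gen (elt x (idm a)))} by exact/cid/gs.
  by exists (fun a x => sval (H a x)) => a x; case: (H a x).
pose h e : {linear free_modfun e -> B e} :=
  free_lift (fun t : elements e => mhom B (projT2 t).2 (b _ (projT2 t).1)).
have hN a c (k : hom a c) (u : free_modfun a) :
    h c (mhom free_modfun k u) = mhom B k (h a u).
  apply: (@free_ext _ _ (h c \o free_hom k) (mhom B k \o h a)) => -[d [x m]].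
  rewrite [LHS](congr1 (h c) (free_lift_gen _ _)).
  rewrite [RHS](congr1 (mhom B k) (free_lift_gen _ _)).
  by rewrite [LHS]free_lift_gen /= mhomM.
exists (mk_nt hN); apply: nt_eq => e u.
apply: (@free_ext _ _ (nt g e \o h e) (nt f e)) => -[a [x k]].
rewrite [LHS](congr1 (nt g e) (free_lift_gen _ _)).
apply: etrans (ntN g k _) _; rewrite /= [X in mhom C k X]bE.
apply: etrans (esym (ntN f k _)) _; congr (nt f e _).
by rewrite [LHS]free_lift_gen /= mcompm1.
Qed.

End Cover.

Section Kernel.
Variables (A B : modfun R E) (f : nattrans A B).

Definition in_ker e (x : A e) : Prop := nt f e x = 0.
Lemma in_ker0 e : @in_ker e 0. Proof. exact: raddf0. Qed.
Lemma in_kerL e a (x y : A e) : in_ker x -> in_ker y -> in_ker (a *: x + y).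
Proof. by rewrite /in_ker linearP => -> ->; rewrite scaler0 addr0. Qed.

Definition ker_ob e : lmodType R := subm (submod_of (@in_ker0 e) (@in_kerL e)).

Lemma ker_hom_subproof a b (k : hom a b) (x : ker_ob a) :
  mhom A k (val x) \in submod_of (@in_ker0 b) (@in_kerL b).
Proof.
apply/submod_ofP; have /submod_ofP xk := valP x.
by rewrite /in_ker ntN xk raddf0.
Qed.
Definition ker_hom_fun a b (k : hom a b) (x : ker_ob a) : ker_ob b :=
  exist _ (mhom A k (val x)) (ker_hom_subproof k x).
Lemma ker_hom_linear a b (k : hom a b) : linear (ker_hom_fun k).
Proof. by move=> c x y; apply: val_inj; rewrite /= !linearP. Qed.
Lemma ker_hom1 a (x : ker_ob a) : ker_hom_fun (idm a) x = x.
Proof. by apply: val_inj; rewrite /= mhom1. Qed.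
Lemma ker_homM a b c (g : hom b c) (k : hom a b) (x : ker_ob a) :
  ker_hom_fun (g \oc k) x = ker_hom_fun g (ker_hom_fun k x).
Proof. by apply: val_inj; rewrite /= mhomM. Qed.

Definition ker_modfun : modfun R E :=
  @ModFun R E ker_ob (fun a b k => mk_linear (ker_hom_linear k)) ker_hom1 ker_homM.

Definition ker_incl_fun e (x : ker_modfun e) : A e := val x.
Lemma ker_incl_linear e : linear (@ker_incl_fun e).
Proof. by []. Qed.
Lemma ker_incl_natural a b (k : hom a b) (x : ker_modfun a) :
  ker_incl_fun (mhom ker_modfun k x) = mhom A k (ker_incl_fun x).
Proof. by []. Qed.
Definition ker_incl : nattrans ker_modfun A :=
  @mk_nt R E ker_modfun A (fun e => mk_linear (@ker_incl_linear e)) ker_incl_natural.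

Lemma ker_inclP e (x : A e) : nt f e x = 0 <-> exists y, nt ker_incl e y = x.
Proof.
split=> [fx|[y <-]]; last by have /submod_ofP := valP y.
have xk : x \in submod_of (@in_ker0 e) (@in_kerL e) by apply/submod_ofP.
by exists (exist _ x xk : ker_ob e).
Qed.

End Kernel.

Section FreeResolution.
Variable A : modfun R E.

Fixpoint syzygy n : modfun R E :=
  if n is m.+1 then ker_modfun (free_cover (syzygy m)) else A.

Definition free_res_ob n : modfun R E := free_modfun (syzygy n).
Definition free_res_d n : nattrans (free_res_ob n.+1) (free_res_ob n) :=
  nt_comp (ker_incl (free_cover (syzygy n))) (free_cover (syzygy n.+1)).
Definition free_res_aug : nattrans (free_res_ob 0) A := free_cover A.

Lemma free_res_exactP n e (y : free_res_ob n e) :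
  nt (free_cover (syzygy n)) e y = 0 <-> exists x, nt (free_res_d n) e x = y.
Proof.
split=> [/ker_inclP[z <-]|[x <-]].
  by have [x <-] := cover_surj z; exists x.
by apply/ker_inclP; exists (nt (free_cover (syzygy n.+1)) e x).
Qed.

Lemma free_res_exact0 : nt_exact (free_res_d 0) free_res_aug.
Proof. by move=> e y; exact: (@free_res_exactP 0 e y). Qed.

Lemma free_res_exact n : nt_exact (free_res_d n.+1) (free_res_d n).
Proof.
move=> e y; apply: iff_trans (@free_res_exactP n.+1 e y).
split=> [y0|y0]; last first.
  by rewrite -[LHS]/(nt (ker_incl _) e (nt (free_cover (syzygy n.+1)) e y)) y0 raddf0.
by apply: val_inj; exact: y0.
Qed.

Definition free_resolution : projective_resolution A :=
  ProjectiveResolution (fun n => @free_projective (syzygy n))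
    (@cover_surj A) free_res_exact0 free_res_exact.

End FreeResolution.

(* Computed from one chosen projective resolution; the others give isomorphic   *)
(* modules.                                                                     *)
Definition Ext (n : nat) (A B : modfun R E) : lmodType R :=
  cohomology (hom_complex B (free_resolution A)) n.

(* H^n(E; A) *)
Definition cat_cohomology (A : modfun R E) (n : nat) : lmodType R :=
  Ext n (const_modfun E (R^o : lmodType R)) A.

End Ext.

Section SpectralSequences.
Variable R : comPzRingType.

Definition linear_iso (U V : lmodType R) : Prop :=
  exists f : {linear U -> V}, bijective f.

(* The r-th page of a first quadrant cohomological spectral sequence: the        *)
(* modules E^{p,q} with p < 0 or q < 0 are zero and are left out.  There is a     *)
(* map between any two bidegrees; all of them vanish, except those of            *)
(* bidegree (r, 1 - r).                                                          *)
Record page (r : nat) := Page {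
  pg :> nat -> nat -> lmodType R;
  pd : forall p q p' q', {linear pg p q -> pg p' q'};
  pd_degree : forall p q p' q' (x : pg p q),
    ~ (p' = p + r /\ q' + r = q + 1)%N -> pd p q p' q' x = 0;
  pdd : forall p q p' q' p'' q'' (x : pg p q),
    pd p' q' p'' q'' (pd p q p' q' x) = 0 }.

Section PageHomology.
Variables (r : nat) (E : page r) (p q : nat).

Definition page_cycle (x : E p q) : Prop := forall p' q', pd E p q p' q' x = 0.
Definition page_boundary (x : E p q) : Prop :=
  exists p0 q0 (y : E p0 q0), pd E p0 q0 p q y = x.

Lemma page_cycle0 : page_cycle 0.
Proof. by move=> p' q'; exact: raddf0. Qed.
Lemma page_cycleL a u v : page_cycle u -> page_cycle v -> page_cycle (a *: u + v).
Proof. by move=> uC vC p' q'; rewrite linearP uC vC scaler0 addr0. Qed.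
Lemma page_boundary0 : page_boundary 0.
Proof. by exists p, q, 0; exact: raddf0. Qed.
Lemma page_boundaryL a u v :
  page_boundary u -> page_boundary v -> page_boundary (a *: u + v).
Proof.
move=> [p0 [q0 [x <-]]] [p1 [q1 [y <-]]].
have [e0|/pd_degree ->] := pselect (p = p0 + r /\ q + r = q0 + 1)%N; last first.
  by rewrite scaler0 add0r; exists p1, q1, y.
have [e1|/pd_degree ->] := pselect (p = p1 + r /\ q + r = q1 + 1)%N; last first.
  by exists p0, q0, (a *: x); rewrite linearZ_LR addr0.
have ep : p0 = p1 by lia.
have eq : q0 = q1 by lia.
case: p1 / ep y {e1} => y; case: q1 / eq y => y.
by exists p0, q0, (a *: x + y); rewrite linearP.
Qed.

Definition page_homology : lmodType R :=
  subquot (submod_of page_cycle0 page_cycleL)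
          (submod_of page_boundary0 page_boundaryL).

End PageHomology.

(* The sequence starts at the page r = 2: pages 0 and 1 carry no information.    *)
Record spectral_sequence := SpectralSequence {
  ss :> forall r, page r;
  ss_next : forall r p q, (2 <= r)%N ->
    linear_iso (ss r.+1 p q) (page_homology (ss r) p q) }.

(* Convergence to H: each H n has a finite filtration H n = F^0 >= F^1 >= ... >=  *)
(* F^(n+1) = 0 with F^p / F^(p+1) = E_oo^{p,n-p}.  In the first quadrant, every   *)
(* page E_r^{p,q} with r > p and r > q + 1 is E_oo^{p,q}, because no nonzero     *)
(* differential d_s with s >= r enters or leaves the bidegree (p,q).             *)
Definition converges (E : spectral_sequence) (H : nat -> lmodType R) : Prop :=
  exists F : forall n : nat, nat -> submodClosed (H n),
    [/\ forall n x, x \in F n 0,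
        forall n p x, x \in F n p.+1 -> x \in F n p,
        forall n x, x \in F n n.+1 -> x = 0 &
        forall r p q, (p < r)%N -> (q.+1 < r)%N ->
          linear_iso (E r p q) (subquot (F (p + q)%N p) (F (p + q)%N p.+1))].

End SpectralSequences.

(* Main.v *)
From mathcomp Require Import all_boot all_order all_algebra.
From mathcomp Require Import boolp zify.
Require Import Defs.

Set Implicit Arguments.
Unset Strict Implicit.
Unset Printing Implicit Defensive.

Import GRing.Theory.
Local Open Scope ring_scope.

(* For any functor pi : C -> D, let X^q be the D^op-module d |-> C^q(N(pi/d);   *)
(* j^*M), and let P be the free resolution of the constant module R. The double *)
(* complex K^{p,q} = Hom(P_p, X^q) gives the spectral sequence. Since each P_p  *)
(* is projective, taking vertical cohomology first yields Hom(P_p, H^q), hence  *)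
(* the E_2 page. On the other hand X^q(d) = prod_s Map(Hom(pi(s_q), d), M(s)),  *)
(* over the q-simplices s of NC, is a product of coinduced modules, so maps     *)
(* into X^q extend along monomorphisms that have objectwise, not necessarily    *)
(* natural, linear retractions. The syzygies of P have such retractions because *)
(* R and the P_p(d) are free; thus the rows of K are exact resolutions of       *)
(* C^q(NC; M), and the total complex computes H(NC; M).                         *)

(** Write X^q(d) for the q-cochains of N(pi/d) with coefficients j^*M. Restricting a cochain of NC
    to every comma category identifies C^q(NC; M) with Hom(R, X^q) ([const_pull_surj],
    [const_pull_inj]), so the theorem is a hyper-Ext spectral sequence for the constant module R and
    the complex X, once the X^q are known to be acyclic for Hom(R, -).

    Acyclicity is the geometric point. A q-simplex of N(pi/d) amounts to a q-simplex s of NC with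
    one arrow pi(s_q) -> d, the other structure maps being composites ([can_over_push]). So X^q is a
    product of coinduced modules, and a map into it extends along any inclusion that has linear
    retractions object by object ([coextE]). The syzygies of the free resolution have such
    retractions ([syzygy_retraction]), and the rows are exact ([row_exact], [row_aug_ex]).

    The rest is homological algebra. [filt_page_next] and [filt_spectral_converges] construct the
    spectral sequence of a filtered complex and its limit; [aug_lift] shows that the augmentation of
    a double complex with exact rows induces an isomorphism in cohomology; [hyper_spectral2]
    computes the second page, using through [im_delta_lift] that Hom(P_p, -) is exact. *)

Section LinearRelations.
Variable R : comPzRingType.

Lemma linear_iso_rel (U V : lmodType R) (Q : U -> V -> Prop) :
  (forall a x y x' y', Q x y -> Q x' y' -> Q (a *: x + x') (a *: y + y')) ->
  (forall x, exists y, Q x y) -> (forall y, exists x, Q x y) ->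
  (forall y, Q 0 y -> y = 0) -> (forall x, Q x 0 -> x = 0) ->
  linear_iso U V.
Proof.
move=> QL Qx Qy Q0 Q1.
have N1K (W : lmodType R) (w : W) : -1 *: w + w = 0 by rewrite scaleN1r addNr.
have Ql x y y' : Q x y -> Q x y' -> y = y'.
  move=> xy xy'; apply/esym/subr0_eq; rewrite addrC -scaleN1r.
  by apply: Q0; rewrite -(N1K _ x); exact: QL.
have Qr x x' y : Q x y -> Q x' y -> x = x'.
  move=> xy xy'; apply/esym/subr0_eq; rewrite addrC -scaleN1r.
  by apply: Q1; rewrite -(N1K _ y); exact: QL.
pose f x := sval (cid (Qx x)); pose g y := sval (cid (Qy y)).
have fP x : Q x (f x) by rewrite /f; case: cid.
have gP y : Q (g y) y by rewrite /g; case: cid.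
have fL : linear f by move=> a u v; apply: Ql (fP _) (QL _ _ _ _ _ (fP u) (fP v)).
exists (mk_linear fL); exists g => [x|y]; first exact: Qr (gP (f x)) (fP x).
exact: Ql (fP (g y)) (gP y).
Qed.

Lemma subclass0P (V : lmodType R) (Z B : submodClosed V) (z : subm Z) :
  subclass B z = 0 <-> val z \in B.
Proof.
have -> : 0 = subclass B (0 : subm Z).
  by symmetry; exact: (linear0 (mk_linear (@subclass_linear R V Z B))).
apply: (iff_trans (subclass_eq _ _ _)).
by have -> : val (0 : subm Z) = 0 by []; rewrite subr0.
Qed.

(** Comparisons of pages use a relation between representatives because passing from one side to the
    other involves choices (lifts, correction terms); only the induced map on classes is
    single-valued. *)
Lemma subquot_iso (V W : lmodType R) (Z B : submodClosed V) (Z' B' : submodClosed W)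
    (Q : V -> W -> Prop) :
  (forall a x y x' y', Q x y -> Q x' y' -> Q (a *: x + x') (a *: y + y')) ->
  (forall x, x \in Z -> exists2 y, y \in Z' & Q x y) ->
  (forall y, y \in Z' -> exists2 x, x \in Z & Q x y) ->
  (forall x y, x \in Z -> y \in Z' -> Q x y -> (x \in B <-> y \in B')) ->
  linear_iso (subquot Z B) (subquot Z' B').
Proof.
move=> QL Qx Qy QB.
pose Q' (x : subquot Z B) (y : subquot Z' B') := exists z w, [/\ subclass B z = x, subclass B' w = y & Q (val z) (val w)].
apply: (@linear_iso_rel (subquot Z B) (subquot Z' B') Q').
- move=> a x y x' y' [z [w [<- <- zw]]] [z' [w' [<- <- zw']]].
  exists (a *: z + z'), (a *: w + w').
  split; [exact: subclass_linear|exact: subclass_linear|rewrite !linearP; exact: QL].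
- move=> x; have [z <-] := subclass_surj x; have [y yZ zy] := Qx _ (valP z).
  by exists (subclass B' (exist _ y yZ)); exists z, (exist _ y yZ).
- move=> y; have [w <-] := subclass_surj y; have [x xZ xw] := Qy _ (valP w).
  by exists (subclass B (exist _ x xZ)); exists (exist _ x xZ), w.
- move=> y [z [w [/subclass0P zB <- zw]]]; apply/subclass0P.
  by apply/(QB _ _ _ _ zw) => //; exact: valP.
- move=> y [z [w [<- /subclass0P zB zw]]]; apply/subclass0P.
  by apply/(QB _ _ _ _ zw) => //; exact: valP.
Qed.

End LinearRelations.

(** * The spectral sequence of a filtered complex *)

Section FilteredComplex.
Variables (R : comPzRingType) (T : lmodType R) (d : {linear T -> T}).
Hypothesis dd : forall x, d (d x) = 0.

(* [G k p] is the [p]-th filtration step in degree [k - 1]: the shift makes room *)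
(* for the degree -1, where everything vanishes.                                 *)
Variable G : nat -> nat -> T -> Prop.
Hypothesis G_zero : forall k p, G k p 0.
Hypothesis G_lin : forall k p a x y, G k p x -> G k p y -> G k p (a *: x + y).
Hypothesis G_le : forall k p p' x, (p <= p')%N -> G k p' x -> G k p x.
Hypothesis G_big : forall k p x, (k <= p)%N -> G k p x -> x = 0.

Lemma filtD k p x y : G k p x -> G k p y -> G k p (x + y).
Proof. by move=> xG yG; rewrite -[x]scale1r; exact: G_lin. Qed.

Lemma filtN k p x : G k p x -> G k p (- x).
Proof. by move=> xG; rewrite -scaleN1r -[_ *: _]addr0; exact: G_lin. Qed.

Lemma filtB k p x y : G k p x -> G k p y -> G k p (x - y).
Proof. by move=> xG yG; apply: filtD => //; exact: filtN. Qed.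

Definition filt_cycle r p q x : Prop :=
  G (p + q).+1 p x /\ G (p + q).+2 (p + r) (d x).

(* The subtraction [p.+1 - r] is truncated: for r > p + 1 the bound F^(p+1-r)   *)
(* with a negative index is all of the module.                                  *)
Definition filt_boundary r p q x : Prop := exists y z,
  [/\ x = d y + z, G (p + q) (p.+1 - r) y,
      G (p + q).+1 p.+1 z & G (p + q).+2 (p + r) (d z)].

Lemma filt_cycle0 r p q : filt_cycle r p q 0.
Proof. by split; rewrite ?raddf0; exact: G_zero. Qed.
Lemma filt_cycleL r p q a x y :
  filt_cycle r p q x -> filt_cycle r p q y -> filt_cycle r p q (a *: x + y).
Proof. by move=> [x1 x2] [y1 y2]; split; rewrite ?linearP; exact: G_lin. Qed.
Lemma filt_boundary0 r p q : filt_boundary r p q 0.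
Proof. by exists 0, 0; split; rewrite ?raddf0 ?addr0 //; exact: G_zero. Qed.
Lemma filt_boundaryL r p q a x y : filt_boundary r p q x -> filt_boundary r p q y ->
  filt_boundary r p q (a *: x + y).
Proof.
move=> [y1 [z1 [-> ? ? ?]]] [y2 [z2 [-> ? ? ?]]].
exists (a *: y1 + y2), (a *: z1 + z2); split; rewrite ?linearP; do ?exact: G_lin.
by rewrite scalerDr addrACA.
Qed.

Definition filt_cycles r p q := submod_of (@filt_cycle0 r p q) (@filt_cycleL r p q).
Definition filt_boundaries r p q :=
  submod_of (@filt_boundary0 r p q) (@filt_boundaryL r p q).

(** [subquot] divides by the intersection with the cycles. For a cycle [x = d y + z] the term [d y]
    lies in F^p because [x] and [z] do, so the denominator is the usual d Z_{r-1}^{p-r+1,q+r-2} +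
    Z_{r-1}^{p+1,q-1}. *)
Definition filt_term r p q : lmodType R := subquot (filt_cycles r p q) (filt_boundaries r p q).

Definition filt_target (r p q p' q' : nat) : Prop := (p' = p + r /\ q' + r = q + 1)%N.

Section Differential.
Variables (r p q p' q' : nat) (e : filt_target r p q p' q').

Lemma filt_target_deg : (p' + q')%N = (p + q).+1.
Proof. by case: e; lia. Qed.

Lemma filt_d_cycle x : x \in filt_cycles r p q -> d x \in filt_cycles r p' q'.
Proof.
move=> /submod_ofP[_ dx]; apply/submod_ofP; split; last by rewrite dd; exact: G_zero.
by rewrite filt_target_deg; have [-> _] := e.
Qed.

Lemma filt_d_boundary x : x \in filt_boundaries r p q -> d x \in filt_boundaries r p' q'.
Proof.
move=> /submod_ofP[y [z [-> _ z1 z2]]]; apply/submod_ofP.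
exists z, 0; rewrite linearD dd add0r addr0 filt_target_deg raddf0.
by split=> //; rewrite ?raddf0; do ?exact: G_zero; apply: G_le z1; case: e; lia.
Qed.

End Differential.

Definition filt_d r p q p' q' : {linear filt_term r p q -> filt_term r p' q'} :=
  match pselect (filt_target r p q p' q') with
  | left e => subq_map (filt_d_cycle e) (filt_d_boundary e)
  | right _ => \0
  end.

Lemma filt_d_degree r p q p' q' (x : filt_term r p q) :
  ~ filt_target r p q p' q' -> filt_d r p q p' q' x = 0.
Proof. by rewrite /filt_d; case: pselect. Qed.

Lemma filt_d_class r p q p' q' (x : subm (filt_cycles r p q))
    (y : subm (filt_cycles r p' q')) :
  filt_target r p q p' q' -> val y = d (val x) ->
  filt_d r p q p' q' (subclass _ x) = subclass _ y.
Proof.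
rewrite /filt_d; case: pselect => // e _ yx; rewrite [LHS]subq_map_class.
by congr subclass; apply: val_inj; rewrite yx.
Qed.

Lemma filt_d_class0P r p q p' q' (x : subm (filt_cycles r p q)) :
  filt_target r p q p' q' ->
  filt_d r p q p' q' (subclass _ x) = 0 <-> filt_boundary r p' q' (d (val x)).
Proof.
rewrite /filt_d; case: pselect => // e _; rewrite [subq_map _ _ _]subq_map_class.
by apply: (iff_trans (subclass0P _ _)); exact: submod_ofP.
Qed.

Lemma filt_dd r p q p' q' p'' q'' (x : filt_term r p q) :
  filt_d r p' q' p'' q'' (filt_d r p q p' q' x) = 0.
Proof.
have [e|/filt_d_degree ->] := pselect (filt_target r p q p' q'); last exact: raddf0.
have [e'|/filt_d_degree ->//] := pselect (filt_target r p' q' p'' q'').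
have [z <-] := subclass_surj x.
rewrite (filt_d_class (y := subm_map (filt_d_cycle e) z))//.
apply/filt_d_class0P => //=; rewrite dd; exact: filt_boundary0.
Qed.

Definition filt_page r : page R r := Page (@filt_d_degree r) (@filt_dd r).

Lemma filt_page_next r p q : (2 <= r)%N ->
  linear_iso (filt_page r.+1 p q) (page_homology (filt_page r) p q).
Proof.
move=> r2.
pose Q (x : T) (u : filt_term r p q) :=
  exists2 z : subm (filt_cycles r p q), subclass _ z = u & val z = x.
have cyc0 x : filt_cycle r.+1 p q x -> filt_cycle r p q x.
  by move=> [x1 x2]; split=> //; apply: G_le x2; lia.
apply: (@subquot_iso R T (filt_term r p q) _ _ _ _ Q).
- move=> a x u x' u' [z <- <-] [z' <- <-]; exists (a *: z + z'); last by rewrite linearP.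
  exact: subclass_linear.
- move=> x /submod_ofP xZ; have xZr : x \in filt_cycles r p q by apply/submod_ofP/cyc0.
  pose z : subm (filt_cycles r p q) := exist _ x xZr.
  exists (subclass _ z); last by exists z.
  apply/submod_ofP => p' q'.
  have [e|/filt_d_degree->//] := pselect (filt_target r p q p' q').
  apply/filt_d_class0P => //=; exists 0, (d x).
  rewrite raddf0 add0r dd (filt_target_deg e).
  split=> //; do ?exact: G_zero.
  by case: xZ => _; rewrite addnS; case: e => -> _.
- move=> u /submod_ofP uC; have [z zu] := subclass_surj u.
  have /submod_ofP[z1 z2] := valP z.
  (* For r > q + 1 the differential has no target in the first quadrant; there [d z] has filtration
     beyond its degree, so it is zero. *)
  have [rq|qr] := leqP r q.+1; last first.
    exists (val z); last by exists z.
    apply/submod_ofP; split=> //.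
    by rewrite (G_big _ z2); [exact: G_zero | lia].
  have e : filt_target r p q (p + r) (q.+1 - r) by split; lia.
  have := uC (p + r)%N (q.+1 - r)%N; rewrite -zu => /(filt_d_class0P z e).
  rewrite /filt_boundary (filt_target_deg e) => -[y [w [dz y1 w1 w2]]].
  (* Since [y] has filtration p + 1, subtracting it keeps the class on page r and pushes the
     differential of the representative one step deeper. *)
  have y1' : G (p + q).+1 p.+1 y by apply: G_le y1; lia.
  have dy : d (val z - y) = w by rewrite linearB dz addrC addKr.
  have zyC : filt_cycle r.+1 p q (val z - y).
    split; last by rewrite dy addnS.
    by apply: filtB => //; apply: G_le y1'.
  have zyCr : val z - y \in filt_cycles r p q by apply/submod_ofP/cyc0.
  exists (val z - y); first exact/submod_ofP.
  exists (exist _ (val z - y) zyCr) => //.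
  apply/subclass_eq/submod_ofP => /=; exists 0, (- y).
  rewrite raddf0 add0r addrAC subrr add0r; split=> //; try exact: G_zero.
    exact: filtN.
  have -> : d (- y) = w - d (val z) by rewrite dz [d y + w]addrC opprD addrA subrr add0r raddfN.
  by apply: filtB => //; apply: G_le w1.
- move=> x u /submod_ofP xZ _ [z <- zx]; split.
  + move=> /submod_ofP[y [w [xE y1 w1 w2]]]; apply/submod_ofP.
    have wB : filt_boundary r p q w.
      by exists 0, w; rewrite raddf0 add0r; split=> //; apply: G_le w2; lia.
    (* For r > p no differential enters: the truncated bounds p + 1 - r and p - r are both 0, so [x]
       is already a boundary on page r and its class is the image of 0. *)
    have [rp|pr] := leqP r p; last first.
      exists p, q, 0; rewrite raddf0; symmetry; apply/subclass0P/submod_ofP.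
      rewrite zx xE; exists y, w; split=> //; first by apply: G_le y1; lia.
      by apply: G_le w2; lia.
    have e : filt_target r (p - r) (q + r).-1 p q by split; lia.
    have deg := filt_target_deg e.
    have yC : y \in filt_cycles r (p - r) (q + r).-1.
      apply/submod_ofP; split; rewrite -deg; first by apply: G_le y1; lia.
      have -> : d y = x - w by rewrite xE addrK.
      rewrite subnK//; apply: filtB; first by case: xZ.
      exact: G_le w1.
    exists (p - r)%N, (q + r).-1, (subclass _ (exist _ y yC)).
    rewrite (filt_d_class (y := subm_map (filt_d_cycle e) (exist _ y yC)))//.
    apply/subclass_eq/submod_ofP => /=.
    rewrite zx xE -[_ - _]opprB addrC addKr -scaleN1r -[_ *: _]addr0.
    by apply: filt_boundaryL => //; exact: filt_boundary0.
  + move=> /submod_ofP[p0 [q0 [v vE]]]; apply/submod_ofP.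
    have [e|ne] := pselect (filt_target r p0 q0 p q); last first.
      move: vE; rewrite filt_d_degree// => /esym/subclass0P/submod_ofP.
      rewrite zx => -[y [w [xE y1 w1 w2]]]; exists y, w; split=> //.
        by apply: G_le y1; lia.
      have -> : d w = d x by rewrite xE linearD dd add0r.
      by case: xZ.
    have [w wv] := subclass_surj v; move: vE; rewrite -wv.
    rewrite (filt_d_class (y := subm_map (filt_d_cycle e) w))//.
    move=> /esym/subclass_eq/submod_ofP /= [y [t [xE y1 t1 t2]]].
    have xE' : x = d (val w + y) + t by rewrite linearD -addrA -xE addrC subrK zx.
    have deg := filt_target_deg e.
    exists (val w + y), t; split=> //.
      apply: filtD; last by apply: G_le y1; lia.
      by have /submod_ofP[] := valP w; rewrite deg => + _; apply: G_le; case: e; lia.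
    have -> : d t = d x by rewrite xE' linearD dd add0r.
    by case: xZ.
Qed.

Definition filt_spectral : spectral_sequence R := SpectralSequence filt_page_next.

(** * Convergence to the cohomology of a complex mapped quasi-isomorphically into the filtered
    one *)

Section Convergence.
Variables (C : complex R) (eps : forall n, {linear C n -> T}).
Hypothesis eps_deg : forall n c, G n.+1 0 (eps n c).
Hypothesis eps_d : forall n c, d (eps n c) = eps n.+1 (cd C n c).
Hypothesis eps_inj : forall n c, eps n c = 0 -> c = 0.
Hypothesis eps_lift : forall n x, G n.+1 0 x -> (exists c, d x = eps n.+1 c) ->
  exists c w, G n 0 w /\ x = eps n c + d w.

(** [eps_lift] gives surjectivity in cohomology when [d x = 0]; applied to [y] here, it also gives
    injectivity, as [y = eps b + d w] forces [eps c = eps (cd b)]. *)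
Lemma eps_coboundary n c y : G n 0 y -> eps n c = d y -> @is_coboundary R C n c.
Proof.
case: n c => [|n] c y1 cy.
  by apply: eps_inj; rewrite cy (G_big _ y1) ?raddf0.
have [|b [w [w1 yE]]] := eps_lift y1; first by exists c.
exists b; apply/eqP; rewrite -subr_eq0; apply/eqP; apply: (@eps_inj n.+1).
by rewrite linearB cy yE linearD dd addr0 -eps_d subrr.
Qed.

(* The image of H(F^p T), transported to C along eps.                           *)
Definition filt_cohomology n p (h : cohomology C n) : Prop :=
  exists z y, [/\ subclass _ z = h, G n 0 y & G n.+1 p (eps n (val z) + d y)].

Lemma filt_cohomology0 n p : filt_cohomology p (0 : cohomology C n).
Proof.
exists 0, 0; split; first exact/subclass0P/submod_ofP/coboundary0.
  exact: G_zero.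
have -> : val (0 : subm (cocycles C n)) = 0 by [].
by rewrite !raddf0 addr0; exact: G_zero.
Qed.
Lemma filt_cohomologyL n p a (u v : cohomology C n) :
  filt_cohomology p u -> filt_cohomology p v -> filt_cohomology p (a *: u + v).
Proof.
move=> [z [y [<- y1 zy]]] [z' [y' [<- y1' zy']]].
exists (a *: z + z'), (a *: y + y'); split.
- exact: subclass_linear.
- exact: G_lin.
- have -> : val (a *: z + z') = a *: val z + val z' by [].
  by rewrite !linearP addrACA -scalerDr; exact: G_lin.
Qed.

Definition filt_submod n p : submodClosed (cohomology C n) :=
  submod_of (@filt_cohomology0 n p) (@filt_cohomologyL n p).

Lemma filt_spectral_converges : converges filt_spectral (cohomology C).
Proof.
exists filt_submod; split.
- move=> n h; apply/submod_ofP; have [z <-] := subclass_surj h.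
  exists z, 0; rewrite raddf0 addr0; split=> //; exact: G_zero.
- move=> n p h /submod_ofP[z [y [<- y1 zy]]]; apply/submod_ofP; exists z, y; split=> //.
  exact: G_le zy.
- move=> n h /submod_ofP[z [y [<- y1 zy]]]; apply/subclass0P/submod_ofP.
  apply: (@eps_coboundary n _ (- y)); first exact: filtN.
  by rewrite raddfN; apply/eqP; rewrite -addr_eq0; apply/eqP/(G_big _ zy).
- move=> r p q pr qr.
  pose Q (x : T) (h : cohomology C (p + q)) := exists z y,
    [/\ subclass _ z = h, G (p + q) 0 y & x = eps _ (val z) + d y].
  apply: (@subquot_iso R T (cohomology C (p + q)) _ _ _ _ Q).
  + move=> a x u x' u' [z [y [<- y1 ->]]] [z' [y' [<- y1' ->]]].
    exists (a *: z + z'), (a *: y + y'); split.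
    * exact: subclass_linear.
    * exact: G_lin.
    * have -> : val (a *: z + z') = a *: val z + val z' by [].
      by rewrite !linearP addrACA -scalerDr.
  + move=> x /submod_ofP[x1 x2].
    (* The bound r > q + 1 turns the cycles of page r into true cycles; r > p will make F^(p+1-r)
       the whole module. *)
    have dx : d x = 0 by apply: (G_big _ x2); lia.
    have [||c [w [w1 xE]]] := @eps_lift (p + q) x; first exact: G_le x1.
      by exists 0; rewrite dx raddf0.
    have cC : c \in cocycles C (p + q).
      apply/submod_ofP; apply: eps_inj; rewrite -eps_d -dx xE linearD dd addr0//.
    exists (subclass _ (exist _ c cC)).
      by apply/submod_ofP; exists (exist _ c cC), w; rewrite /= -xE.
    by exists (exist _ c cC), w.
  + move=> h /submod_ofP[z [y [zh y1 zy]]]; exists (eps _ (val z) + d y).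
      apply/submod_ofP; split=> //; rewrite linearD dd addr0 eps_d.
      have /submod_ofP -> := valP z; rewrite raddf0; exact: G_zero.
    by exists z, y.
  + move=> x h /submod_ofP[x1 x2] _ [z [y [<- y1 xE]]].
    split=> [/submod_ofP[w [t [xE' w1 t1 t2]]]|].
      apply/submod_ofP; exists z, (y - w); split=> //.
        by apply: filtB => //; apply: G_le w1.
      by rewrite linearB addrA -xE xE' addrAC subrr add0r.
    move=> /submod_ofP[z' [y' [/subclass_eq/submod_ofP zz' y1' zy']]].
    apply/submod_ofP.
    have [w w1 wE] : exists2 w, G (p + q) 0 w & eps _ (val z' - val z) = d w.
      move: (p + q)%N (val z' - val z) zz' => -[|n] c /=.
        by move=> ->; exists 0; [exact: G_zero | rewrite !raddf0].
      by move=> [b <-]; exists (eps _ b); [exact: eps_deg | rewrite eps_d].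
    exists (y - y' - w), (eps _ (val z') + d y'); split=> //.
    * have -> : d (y - y' - w) = d y - d y' - d w by rewrite !linearB.
      have zE : eps _ (val z) = eps _ (val z') - d w by rewrite -wE linearB subKr.
      rewrite xE zE [d y - _ - _]addrAC [X in _ = _ + X]addrC addrA subrK.
      by rewrite -addrA addrC [- _ + _]addrC.
    * by have -> : (p.+1 - r = 0)%N by [lia|]; do 2?apply: filtB.
    * rewrite linearD dd addr0 eps_d; have /submod_ofP -> := valP z'.
      rewrite raddf0; exact: G_zero.
Qed.

End Convergence.

End FilteredComplex.

(** * First quadrant double complexes *)

Section DoubleComplex.
Variables (R : comPzRingType) (K : nat -> nat -> lmodType R).
Variables (dh : forall p q, {linear K p q -> K p.+1 q})
          (dv : forall p q, {linear K p q -> K p q.+1}).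
Hypothesis dhh : forall p q x, dh p.+1 q (dh p q x) = 0.
Hypothesis dvv : forall p q x, dv p q.+1 (dv p q x) = 0.
Hypothesis dhv : forall p q x, dh p q.+1 (dv p q x) = dv p.+1 q (dh p q x).

(* All bidegrees at once; homogeneous elements are singled out by [tot_filt].    *)
Definition total : lmodType R := prodm (fun p => (prodm (fun q => K p q) : lmodType R)).

Lemma total_eq (x y : total) : (forall p q, x p q = y p q) -> x = y.
Proof.
move=> xy; apply: functional_extensionality_dep => p.
by apply: functional_extensionality_dep => q.
Qed.

Definition total_h (x : total) : total := fun p q =>
  match p with 0 => 0 | p'.+1 => dh p' q (x p' q) end.
Definition total_v (x : total) : total := fun p q =>
  match q with 0 => 0 | q'.+1 => (-1) ^+ p *: dv p q' (x p q') end.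

Lemma total_h_linear : linear total_h.
Proof.
move=> a x y; apply: total_eq => -[|p] q; last exact: linearP.
by rewrite -[RHS]/(a *: (0 : K 0 q) + 0) scaler0 addr0.
Qed.
Lemma total_v_linear : linear total_v.
Proof.
move=> a x y; apply: total_eq => p [|q].
  by rewrite -[RHS]/(a *: (0 : K p 0) + 0) scaler0 addr0.
rewrite -[RHS]/(a *: ((-1) ^+ p *: dv p q (x p q)) + (-1) ^+ p *: dv p q (y p q)).
rewrite -[LHS]/((-1) ^+ p *: dv p q (a *: x p q + y p q)).
by rewrite linearP scalerDr !scalerA mulrC.
Qed.

Definition total_d_fun (x : total) : total := total_h x + total_v x.
Lemma total_d_linear : linear total_d_fun.
Proof.
by move=> a x y; rewrite /total_d_fun total_h_linear total_v_linear scalerDr addrACA.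
Qed.
Definition total_d : {linear total -> total} := mk_linear total_d_linear.

Lemma total_dE x p q : total_d x p q = total_h x p q + total_v x p q.
Proof. by []. Qed.

Lemma total_dd x : total_d (total_d x) = 0.
Proof.
apply: total_eq => p q; rewrite -[RHS]/(0 : K p q) total_dE.
have hE p0 q0 : total_h (total_d x) p0.+1 q0 = dh p0 q0 (total_v x p0 q0).
  rewrite -[LHS]/(dh p0 q0 (total_h x p0 q0 + total_v x p0 q0)) linearD.
  by case: p0 => [|p0] /=; rewrite ?dhh ?raddf0 add0r.
have vE p0 q0 : total_v (total_d x) p0 q0.+1 = (-1) ^+ p0 *: dv p0 q0 (total_h x p0 q0).
  rewrite -[LHS]/((-1) ^+ p0 *: dv p0 q0 (total_h x p0 q0 + total_v x p0 q0)) linearD.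
  by case: q0 => [|q0] /=; rewrite ?[dv _ _ (_ *: _)]linearZ ?dvv ?raddf0 ?scaler0 addr0.
case: p => [|p]; case: q => [|q].
- by rewrite addr0.
- by rewrite vE add0r /= raddf0 scaler0.
- by rewrite hE addr0 /= raddf0.
- rewrite hE vE /= [dh _ _ (_ *: _)]linearZ dhv /= -scalerDl exprS mulN1r.
  by rewrite addrN scale0r.
Qed.

Definition tot_filt k p (x : total) : Prop :=
  forall p' q', ~ ((p' + q').+1 = k /\ (p <= p')%N) -> x p' q' = 0.

Lemma tot_filt0 k p : tot_filt k p 0.
Proof. by []. Qed.
Lemma tot_filt_lin k p a x y :
  tot_filt k p x -> tot_filt k p y -> tot_filt k p (a *: x + y).
Proof.
move=> xF yF p' q' n; rewrite -[LHS]/(a *: x p' q' + y p' q') xF// yF//.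
by rewrite scaler0 addr0.
Qed.
Lemma tot_filt_d k p x : tot_filt k p x -> tot_filt k.+1 p (total_d x).
Proof.
move=> xF p' q' n; rewrite total_dE.
have -> : total_h x p' q' = 0.
  by case: p' n => //= p' n; rewrite xF ?raddf0// => -[? ?]; apply: n; split; lia.
have -> : total_v x p' q' = 0; last exact: addr0.
by case: q' n => //= q' n; rewrite xF ?raddf0 ?scaler0// => -[? ?]; apply: n; split; lia.
Qed.
Lemma tot_filt_le k p p' x : (p <= p')%N -> tot_filt k p' x -> tot_filt k p x.
Proof. by move=> pp xF p0 q0 n; apply: xF => -[? ?]; apply: n; split; lia. Qed.
Lemma tot_filt_big k p x : (k <= p)%N -> tot_filt k p x -> x = 0.
Proof. by move=> kp xF; apply: total_eq => p0 q0; apply: xF => -[? ?]; lia. Qed.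

Lemma tot_filtB k p x y : tot_filt k p x -> tot_filt k p y -> tot_filt k p (x - y).
Proof. exact: (filtB tot_filt0 tot_filt_lin). Qed.

(** In a fixed total degree, column p contains just the bidegree (p,q). *)
Lemma tot_filtS k p x q : tot_filt k p x -> (p + q).+1 = k -> x p q = 0 ->
  tot_filt k p.+1 x.
Proof.
move=> xF kE x0 p' q' n; have [pp|pp] := eqVneq p p'; last by apply: xF => -[? ?]; lia.
case: p' / pp n => n; have [<-//|qq] := eqVneq q q'.
by apply: xF => -[? ?]; lia.
Qed.

Definition single p q (v : K p q) : total := fun p' q' =>
  match pselect (p = p'), pselect (q = q') with
  | left ep, left eq => ecast a (K a q') ep (ecast b (K p b) eq v)
  | _, _ => 0
  end.

Lemma single_same p q (v : K p q) : single v p q = v.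
Proof.
rewrite /single; case: pselect => // ep; case: pselect => // eq.
by rewrite (Prop_irrelevance ep erefl) (Prop_irrelevance eq erefl).
Qed.

Lemma single_other p q (v : K p q) p' q' : ~ (p = p' /\ q = q') -> single v p' q' = 0.
Proof.
by rewrite /single; case: pselect => // ep; case: pselect => // eq n; case: n.
Qed.

Lemma single_linear p q : linear (@single p q).
Proof.
move=> a u v; apply: total_eq => p' q'.
rewrite -[RHS]/(a *: single u p' q' + single v p' q').
have [[ep eq]|n] := pselect (p = p' /\ q = q').
  by case: p' / ep; case: q' / eq; rewrite !single_same.
by rewrite !single_other// scaler0 addr0.
Qed.

Lemma single0 p q : single (0 : K p q) = 0.
Proof. exact: (linear0 (mk_linear (@single_linear p q))). Qed.

Lemma single_filt p q (v : K p q) : tot_filt (p + q).+1 p (single v).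
Proof. by move=> p' q' n; apply: single_other => -[? ?]; apply: n; split; lia. Qed.

Lemma total_d_single p q (v : K p q) :
  total_d (single v) = single (dh p q v) + (-1) ^+ p *: single (dv p q v).
Proof.
apply: total_eq => p' q'; rewrite total_dE.
rewrite -[RHS]/(single (dh p q v) p' q' + (-1) ^+ p *: single (dv p q v) p' q').
congr (_ + _).
  case: p' => [|p'] /=; first by rewrite single_other// => -[].
  have [[ep eq]|n] := pselect (p = p' /\ q = q').
    by case: p' / ep; case: q' / eq; rewrite !single_same.
  by rewrite !single_other ?raddf0// => -[[e1] e2]; apply: n.
case: q' => [|q'] /=; first by rewrite single_other ?scaler0// => -[].
have [[ep eq]|n] := pselect (p = p' /\ q = q').
  by case: p' / ep; case: q' / eq; rewrite !single_same.
by rewrite !single_other ?raddf0 ?scaler0// => -[e1 [e2]]; apply: n.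
Qed.

Section Augmentation.
Variables (C : complex R) (eta : forall q, {linear C q -> K 0 q}).
Hypothesis eta_d : forall q c, eta q.+1 (cd C q c) = dv 0 q (eta q c).
Hypothesis eta_inj : forall q c, eta q c = 0 -> c = 0.
Hypothesis eta_ex : forall q x, dh 0 q x = 0 <-> exists c, eta q c = x.
Hypothesis dh_ex : forall p q x, dh p.+1 q x = 0 -> exists y, dh p q y = x.

Definition aug_fun q (c : C q) : total := single (eta q c).
Lemma aug_linear q : linear (@aug_fun q).
Proof. by move=> a u v; rewrite /aug_fun linearP single_linear. Qed.
Definition aug q : {linear C q -> total} := mk_linear (@aug_linear q).

Lemma aug_deg q c : tot_filt q.+1 0 (aug q c).
Proof. exact: (@single_filt 0 q). Qed.

Lemma dh_eta q c : dh 0 q (eta q c) = 0.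
Proof. by apply/eta_ex; exists c. Qed.

Lemma aug_d q c : total_d (aug q c) = aug q.+1 (cd C q c).
Proof.
rewrite [LHS]total_d_single dh_eta expr0 scale1r /= /aug_fun eta_d.
by rewrite single0 add0r.
Qed.

Lemma aug_inj q c : aug q c = 0 -> c = 0.
Proof.
move=> /(congr1 (fun x : total => x 0%N q)); rewrite [LHS]single_same => /eta_inj//.
Qed.

(* Exactness of the rows removes the column of highest index, one at a time.    *)
Lemma total_push n k x : tot_filt n.+1 0 x ->
  (forall p q, total_d x p.+1 q = 0) -> (forall p q, (k < p)%N -> x p q = 0) ->
  exists2 w, tot_filt n 0 w & forall p q, (0 < p)%N -> (x - total_d w) p q = 0.
Proof.
elim: k x => [|k IH] x xF dx xk.
  by exists 0 => // p q p0; rewrite raddf0 subr0 xk.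
have [kn|nk] := leqP k.+1 n; last first.
  by apply: IH => // p q kp; apply: xF => -[? ?]; lia.
pose q := (n - k.+1)%N.
(* Columns beyond k + 1 vanish, so the component of [total_d x] at (k + 2, q) is [dh] of the last
   nonzero one, which is thus a row cycle. *)
have [y yE] : exists y, dh k q y = x k.+1 q.
  apply: dh_ex; have := dx k.+1 q; rewrite total_dE.
  have -> : total_v x k.+2 q = 0; last by rewrite addr0.
  by case: (q) => //= q'; rewrite xk ?raddf0 ?scaler0.
have yF : tot_filt n 0 (single y).
  by have -> : n = (k + q).+1; [rewrite /q; lia | apply: tot_filt_le (single_filt y)].
have [|||w wF xw] := IH (x - total_d (single y)).
- by apply: tot_filtB => //; exact: tot_filt_d.
- by move=> p q0; rewrite linearB total_dd subr0.
- move=> p q0 kp; rewrite total_d_single -[LHS]/(x p q0 - (single (dh k q y) p q0 +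
    (-1) ^+ k *: single (dv k q y) p q0)).
  rewrite [single (dv k q y) p q0]single_other => [|[]]; last by lia.
  rewrite scaler0 addr0; have [[ep eq]|n0] := pselect (k.+1 = p /\ q = q0).
    by case: p / ep kp; case: q0 / eq; rewrite single_same yE subrr.
  rewrite single_other// subr0; have [kp'|pk] := ltnP k.+1 p; first exact: xk.
  by apply: xF => -[? ?]; apply: n0; rewrite /q; split; lia.
- exists (single y + w); first by rewrite -[single y]scale1r; exact: tot_filt_lin.
  have -> : x - total_d (single y + w) = x - total_d (single y) - total_d w.
    by rewrite [total_d _]linearD opprD addrA.
  exact: xw.
Qed.

(** This is the hypothesis [eps_lift] for [aug]. Modulo a boundary [x] lives in column 0; as
    [total_d x] has no component in column 1, what remains is a row cycle and comes from [eta]. *)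
Lemma aug_lift n x : tot_filt n.+1 0 x -> (exists c, total_d x = aug n.+1 c) ->
  exists c w, tot_filt n 0 w /\ x = aug n c + total_d w.
Proof.
move=> xF [c dx].
have [|p q np|w wF xw] := @total_push n n x xF.
- by move=> p q; rewrite dx; apply: single_other => -[].
- by apply: xF => -[? ?]; lia.
pose x' := x - total_d w.
have x'F : tot_filt n.+1 0 x' by apply: tot_filtB => //; exact: tot_filt_d.
have dx' : dh 0 n (x' 0 n) = 0.
  have : total_d x' 1 n = 0 by rewrite linearB total_dd subr0 dx; apply: single_other => -[].
  rewrite total_dE; have -> : total_v x' 1 n = 0; last by rewrite addr0.
  by case: (n) => //= m; rewrite [x' _ _]xw ?raddf0 ?scaler0.
have /eta_ex[b bE] := dx'; exists b, w; split=> //.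
rewrite -[LHS](subrK (total_d w)); congr (_ + _).
apply: total_eq => p q; have [[p0 qn]|pq] := pselect (0%N = p /\ n = q).
  by case: p / p0; case: q / qn; rewrite [RHS]single_same bE.
rewrite [RHS]single_other//; case: p pq => [|p] pq; last exact: xw.
by apply: x'F => -[? ?]; apply: pq; split; lia.
Qed.

End Augmentation.

End DoubleComplex.

(** * Maps from a projective resolution into a complex of modules *)

Section ModfunLifting.
Variables (R : comPzRingType) (E : category).
Implicit Types A B C P : modfun R E.

Section KernelLift.
Variables (A B C : modfun R E) (g : nattrans B C) (f : nattrans A B).
Hypothesis gf : forall e x, nt g e (nt f e x) = 0.

Lemma ker_lift_subproof e (x : A e) :
  nt f e x \in submod_of (@in_ker0 _ _ _ _ g e) (@in_kerL _ _ _ _ g e).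
Proof. exact/submod_ofP/gf. Qed.
Definition ker_lift_fun e (x : A e) : ker_modfun g e :=
  exist _ (nt f e x) (ker_lift_subproof x).
Lemma ker_lift_linear e : linear (@ker_lift_fun e).
Proof. by move=> a x y; apply: val_inj; exact: (linearP (nt f e)). Qed.
Lemma ker_lift_natural a b (k : hom a b) (x : A a) :
  ker_lift_fun (mhom A k x) = mhom (ker_modfun g) k (ker_lift_fun x).
Proof. by apply: val_inj; exact: ntN. Qed.
Definition ker_lift : nattrans A (ker_modfun g) :=
  @mk_nt R E A (ker_modfun g) (fun e => mk_linear (@ker_lift_linear e)) ker_lift_natural.

End KernelLift.

(** Both [f] and [phi] factor through the kernel of [g], onto which [f] is surjective; projectivity
    applies there. *)
Lemma exact_lift A B C P (f : nattrans A B) (g : nattrans B C) (phi : nattrans P B) :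
  nt_exact f g -> projective P -> (forall e u, nt g e (nt phi e u) = 0) ->
  exists psi : nattrans P A, forall e u, nt f e (nt psi e u) = nt phi e u.
Proof.
move=> fg pP gphi.
have gf e x : nt g e (nt f e x) = 0 by apply/fg; exists x.
have fs : nt_surj (ker_lift gf).
  move=> e y; have /fg[x xy] : nt g e (val y) = 0 by have /submod_ofP := valP y.
  by exists x; apply: val_inj.
have [psi psiE] := pP _ _ _ fs (ker_lift gphi).
exists psi => e u.
exact: (congr1 (fun h : nattrans P (ker_modfun g) => ker_incl_fun (nt h e u)) psiE).
Qed.

Lemma nt_comp_linear A B C (psi : nattrans B C) : linear (@nt_comp R E A B C psi).
Proof. by move=> a f g; apply: nt_eq => e x; exact: (linearP (nt psi e)). Qed.

End ModfunLifting.

(** * The hyper-Ext spectral sequence of a complex of modules *)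

Section HyperExt.
Variables (R : comPzRingType) (E : category) (A : modfun R E).
Variable P : projective_resolution A.
Variables (X : nat -> modfun R E) (delta : forall q, nattrans (X q) (X q.+1)).
Hypothesis deltad : forall q e x, nt (delta q.+1) e (nt (delta q) e x) = 0.

(** With [cls_surj] and [cls_ker], this presents [H q] as the objectwise cohomology of [X]. Keeping
    [H] abstract lets [thomason_over], whose functoriality is built separately, take its place. *)
Definition im_delta q e : X q e -> Prop :=
  match q with
  | 0 => fun x => x = 0
  | q'.+1 => fun x => exists y, nt (delta q') e y = x
  end.

Variables (H : nat -> modfun R E) (cls : forall q, nattrans (ker_modfun (delta q)) (H q)).
Hypothesis cls_surj : forall q, nt_surj (cls q).
Hypothesis cls_ker : forall q e (z : ker_modfun (delta q) e),
  nt (cls q) e z = 0 <-> im_delta (nt (ker_incl (delta q)) e z).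

Definition hom_bi (p q : nat) : lmodType R := nattrans (P p) (X q).
Definition hom_h p q : {linear hom_bi p q -> hom_bi p.+1 q} :=
  mk_linear (@hom_d_linear R E A (X q) P p).
Definition hom_v_fun p q (f : hom_bi p q) : hom_bi p q.+1 := nt_comp (delta q) f.
Lemma hom_v_linear p q : linear (@hom_v_fun p q).
Proof. exact: nt_comp_linear. Qed.
Definition hom_v p q : {linear hom_bi p q -> hom_bi p q.+1} := mk_linear (@hom_v_linear p q).

Lemma hom_hh p q f : hom_h p.+1 q (hom_h p q f) = 0.
Proof. exact: hom_dd. Qed.
Lemma hom_vv p q f : hom_v p q.+1 (hom_v p q f) = 0.
Proof. by apply: nt_eq => e x; exact: deltad. Qed.
Lemma hom_hv p q f : hom_h p q.+1 (hom_v p q f) = hom_v p.+1 q (hom_h p q f).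
Proof. exact: nt_eq. Qed.

Lemma hom_vE p q f e x : nt (hom_v p q f) e x = nt (delta q) e (nt f e x).
Proof. by []. Qed.

Local Notation tot := (total hom_bi).
Local Notation dt := (total_d hom_h hom_v).
Local Notation G := (@tot_filt R hom_bi).

Definition hyper_spectral : spectral_sequence R :=
  @filt_spectral R tot dt (total_dd hom_hh hom_vv hom_hv) G
    (@tot_filt0 _ _) (@tot_filt_lin _ _) (@tot_filt_le _ _) (@tot_filt_big _ _).

Lemma ker_val q e (z : ker_modfun (delta q) e) : nt (delta q) e (val z) = 0.
Proof. by have /submod_ofP := valP z. Qed.

Lemma cls_eqP q e (z z' : ker_modfun (delta q) e) : nt (cls q) e z = nt (cls q) e z' <->
  im_delta (nt (ker_incl (delta q)) e z - nt (ker_incl (delta q)) e z').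
Proof.
rewrite -(raddfB (nt (ker_incl (delta q)) e)).
have clsB : nt (cls q) e (z - z') = nt (cls q) e z - nt (cls q) e z' := raddfB _ _ _.
split=> [zz'|/cls_ker]; last by rewrite clsB; exact: subr0_eq.
by apply/cls_ker; rewrite clsB zz' subrr.
Qed.

Lemma total_v_im p q (x : tot) e u : im_delta (nt (total_v hom_v x p q) e u).
Proof.
case: q => [//|q]; exists ((-1) ^+ p *: nt (x p q) e u).
exact: (linearZ_LR (nt (delta q) e)).
Qed.

(** Exactness of Hom(Q, -), applied to X^{q-1} -> ker -> H^q; the [match] accounts for X^{-1} =
    0. *)
Lemma im_delta_lift Q q (psi : nattrans Q (X q)) : projective Q ->
  (forall e u, im_delta (nt psi e u)) ->
  match q return nattrans Q (X q) -> Prop with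
  | 0 => fun psi => psi = 0
  | q'.+1 => fun psi => exists y : nattrans Q (X q'), nt_comp (delta q') y = psi
  end psi.
Proof.
move=> pQ; case: q psi => [|q] psi psi_im; first exact: nt_eq.
have psi_ker e u : nt (delta q.+1) e (nt psi e u) = 0.
  by have [y <-] := psi_im e u; exact: deltad.
have ex : nt_exact (ker_lift (@deltad q)) (cls q.+1).
  move=> e y; apply: (iff_trans (cls_ker y)); split=> -[x xy]; exists x.
    by apply: val_inj.
  by rewrite -xy.
have [|h hE] := exact_lift (phi := ker_lift psi_ker) ex pQ.
  by move=> e u; apply/cls_ker; exact: psi_im.
by exists h; apply: nt_eq => e u; exact: (congr1 val (hE e u)).
Qed.

(** Corrects a vertical coboundary by a total boundary without disturbing the columns before p. The
    sign in the witness cancels that of [total_v]. *)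
Lemma im_delta_total p q (psi : hom_bi p q) :
  (forall e u, im_delta (nt psi e u)) ->
  exists2 y : tot, G (p + q) p y & dt y p q = psi.
Proof.
move=> psi_im; have := im_delta_lift (@pr_projective _ _ _ P p) psi_im.
case: q psi {psi_im} => [|q] psi.
  by move=> ->; exists 0; [exact: tot_filt0 | rewrite raddf0].
move=> [w <-]; exists ((-1) ^+ p *: single w).
  rewrite -[_ *: _]addr0; apply: tot_filt_lin; last exact: tot_filt0.
  by rewrite addnS; exact: single_filt.
rewrite [dt _]linearZ -[LHS]/((-1) ^+ p *: dt (single w) p q.+1).
rewrite total_d_single.
rewrite -[LHS]/((-1) ^+ p *: (single (hom_h p q w) p q.+1 +
                 (-1) ^+ p *: single (hom_v p q w) p q.+1)).
rewrite single_same single_other; last by lia.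
by rewrite add0r scalerA -expr2 sqrr_sign scale1r.
Qed.

Lemma scale_sign_eq0 (V : lmodType R) (p : nat) (v : V) : (-1) ^+ p *: v = 0 -> v = 0.
Proof.
move=> /(congr1 (fun w => (-1) ^+ p *: w)).
by rewrite scalerA -expr2 sqrr_sign scale1r scaler0.
Qed.

Lemma low_hom_v0 k p q (x : tot) : G k p x -> dt x p q.+1 = 0 -> hom_v p q (x p q) = 0.
Proof.
move=> xF; rewrite total_dE.
have -> : total_h hom_h x p q.+1 = 0.
  case: p xF => // p xF; rewrite /total_h xF ; last by lia.
  exact: (raddf0 (hom_h p q.+1)).
by rewrite add0r; exact: scale_sign_eq0.
Qed.

Lemma hyper_spectral2 p q :
  linear_iso (hyper_spectral 2 p q) (cohomology (hom_complex (H q) P) p).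
Proof.
pose Q (x : tot) (phi : nattrans (P p) (H q)) :=
  exists2 zeta : nattrans (P p) (ker_modfun (delta q)),
    nt_comp (ker_incl (delta q)) zeta = x p q & nt_comp (cls q) zeta = phi.
apply: (@subquot_iso R tot (nattrans (P p) (H q)) _ _ _ _ Q).
- move=> a x y x' y' [z zx <-] [z' zx' <-]; exists (a *: z + z').
    by rewrite nt_comp_linear zx zx'.
  exact: nt_comp_linear.
- move=> x /submod_ofP[x1 x2].
  have xv : hom_v p q (x p q) = 0 by apply: low_hom_v0 x1 _; apply: x2; lia.
  have xk e u : nt (delta q) e (nt (x p q) e u) = 0 by rewrite -hom_vE xv.
  exists (nt_comp (cls q) (ker_lift xk)); last first.
    by exists (ker_lift xk) => //; exact: nt_eq.
  apply/submod_ofP/nt_eq => e u; apply/cls_ker.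
  rewrite -[nt (ker_incl _) e _]/(nt (hom_h p q (x p q)) e u).
  (* [dt x] lies in F^(p+2), so its component in column p + 1 is zero. *)
  have hE : hom_h p q (x p q) = - total_v hom_v x p.+1 q.
    apply/eqP; rewrite -addr_eq0; apply/eqP.
    by rewrite -[LHS]/(dt x p.+1 q); apply: x2; lia.
  rewrite hE; have -> : - total_v hom_v x p.+1 q = total_v hom_v (- x) p.+1 q.
    have /= -> := linearN (mk_linear (total_v_linear hom_v)) x.
    by [].
  exact: total_v_im.
- move=> phi /submod_ofP phiC.
  have [zeta zphi] := pr_projective (@cls_surj q) phi.
  pose xpq : hom_bi p q := nt_comp (ker_incl (delta q)) zeta.
  have xv : hom_v p q xpq = 0 by apply: nt_eq => e u; exact: ker_val.
  (* That [phi] is a cocycle only makes the horizontal image of its lift a vertical coboundary; [y],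
     of filtration p + 1, cancels it. *)
  have [|y yF yE] := @im_delta_total p.+1 q (hom_h p q xpq).
    move=> e u; apply/cls_ker.
    by have := congr1 (fun f => nt f e u) phiC; rewrite -zphi.
  exists (single xpq - y); last first.
    exists zeta => //; rewrite -[RHS]/(single xpq p q - y p q) single_same yF ?subr0//.
    by lia.
  apply/submod_ofP; split.
    apply: tot_filtB; first exact: single_filt.
    exact: (tot_filt_le (leqnSn p) yF).
  have dE : dt (single xpq - y) = single (hom_h p q xpq) - dt y.
    by rewrite [LHS]linearB [dt (single _)]total_d_single xv single0 scaler0 addr0.
  rewrite dE addn2; apply: (@tot_filtS _ _ _ _ _ q) => //.
    apply: tot_filtB; first exact: (single_filt (hom_h p q xpq)).
    exact: tot_filt_d.
  by rewrite -[LHS]/(single (hom_h p q xpq) p.+1 q - dt y p.+1 q) single_same yE subrr.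
- move=> x phi /submod_ofP[x1 x2] /submod_ofP phiC [zeta zx zphi].
  have zxE e u : nt (ker_incl (delta q)) e (nt zeta e u) = nt (x p q) e u by rewrite -zx.
  split=> [/submod_ofP[y [z [xE y1 z1 z2]]]|/submod_ofP phiB]; apply/submod_ofP.
  + have xpqE : x p q = total_h hom_h y p q + total_v hom_v y p q.
      by rewrite xE -[LHS]/(dt y p q + z p q) z1 ?addr0 ?total_dE//; lia.
    (* For p = 0 there is no column to the left, so [x p q] is a vertical coboundary and [phi]
       vanishes; otherwise the entry of [y] to the left yields a preimage of [phi]. *)
    case: p Q x1 x2 y1 z1 z2 zeta phi phiC zx zphi zxE xpqE xE
      => [|p] Q x1 x2 y1 z1 z2 zeta phi phiC zx zphi zxE xpqE xE.
      rewrite -zphi; apply: nt_eq => e u; apply/cls_ker; rewrite zxE xpqE /= add0r.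
      exact: total_v_im.
    have dy : dt y p q.+1 = 0.
      have -> : dt y = x - z by rewrite xE addrK.
      by rewrite -[LHS]/(x p q.+1 - z p q.+1) x1 ?z1 ?subr0//; lia.
    rewrite subn2 /= in y1.
    have yv := low_hom_v0 y1 dy.
    have yk e u : nt (delta q) e (nt (y p q) e u) = 0 by rewrite -hom_vE yv.
    exists (nt_comp (cls q) (ker_lift yk)); rewrite -zphi; apply: nt_eq => e u.
    apply/esym/cls_eqP; rewrite zxE xpqE.
    rewrite -[X in X - _]/(nt (hom_h p q (y p q)) e u + nt (total_v hom_v y p.+1 q) e u).
    rewrite addrC addKr; exact: total_v_im.
  (* [y1] matches [x] in column p up to a vertical coboundary and [y2] repairs that, so the
     remainder [x - dt (y1 + y2)] starts in column p + 1. *)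
  + have [y1 [y1F dy1 y1E]] : exists y1 : tot, [/\ G (p + q) (p.+1 - 2) y1,
        G (p + q).+1 p (dt y1) &
        forall e u, im_delta (nt (x p q - dt y1 p q : hom_bi p q) e u)].
      case: p Q x1 x2 zeta phi phiC zx zphi zxE phiB
        => [|p] Q x1 x2 zeta phi phiC zx zphi zxE phiB.
        exists 0; rewrite raddf0; split; [exact: tot_filt0 | exact: tot_filt0 |].
        move=> e u; rewrite subr0 -zxE; apply/cls_ker.
        by have := congr1 (fun f => nt f e u) zphi; rewrite phiB.
      have [psi psiE] := phiB.
      have [xi xiE] := pr_projective (@cls_surj q) psi.
      pose v : hom_bi p q := nt_comp (ker_incl (delta q)) xi.
      have vv : hom_v p q v = 0 by apply: nt_eq => e u; exact: ker_val.
      have dE : dt (single v) = single (hom_h p q v).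
        by rewrite [LHS]total_d_single vv single0 scaler0 addr0.
      exists (single v); rewrite dE; split.
      * by rewrite subn2; exact: single_filt.
      * exact: (single_filt (hom_h p q v)).
      * move=> e u; rewrite single_same.
        rewrite -[nt _ e u]/(nt (x p.+1 q) e u - nt (hom_h p q v) e u) -zxE.
        apply/cls_eqP.
        rewrite -[LHS]/(nt (nt_comp (cls q) zeta) e u) zphi -psiE.
        by rewrite -[RHS]/(nt (nt_comp (cls q) xi) e (nt (pr_d P p) e u)) xiE.
    have [y2 y2F y2E] := im_delta_total y1E.
    exists (y1 + y2), (x - dt (y1 + y2)); split.
    * by rewrite addrC subrK.
    * apply: (filtD (@tot_filt_lin _ _)) => //; apply: tot_filt_le y2F; lia.
    * apply: (@tot_filtS _ _ _ _ _ q) => //.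
        apply: tot_filtB => //; rewrite [dt _]linearD.
        by apply: (filtD (@tot_filt_lin _ _)) => //; exact: tot_filt_d.
      rewrite [dt _]linearD -[LHS]/(x p q - (dt y1 p q + dt y2 p q)) y2E.
      by rewrite [_ + (_ - _)]addrC subrK subrr.
    * by rewrite [dt _]linearB total_dd ?subr0//; [exact: hom_hh|exact: hom_vv|exact: hom_hv].
Qed.

Section Abutment.
Variables (C : complex R) (eta : forall q, {linear C q -> hom_bi 0 q}).
Hypothesis eta_d : forall q c, eta q.+1 (cd C q c) = hom_v 0 q (eta q c).
Hypothesis eta_inj : forall q c, eta q c = 0 -> c = 0.
Hypothesis eta_ex : forall q x, hom_h 0 q x = 0 <-> exists c, eta q c = x.
Hypothesis hom_h_ex : forall p q x, hom_h p.+1 q x = 0 -> exists y, hom_h p q y = x.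

Lemma hyper_spectral_converges : converges hyper_spectral (cohomology C).
Proof.
apply: (@filt_spectral_converges _ _ _ _ _ _ _ _ _ C (aug eta)).
- exact: aug_deg.
- exact: aug_d.
- exact: aug_inj.
- by move=> n x xF dx; apply: aug_lift dx => //; [exact: hom_hh|exact: hom_vv|exact: hom_hv].
Qed.

End Abutment.

End HyperExt.

(** * Cochains of the comma categories as coinduced modules *)

Section OverCochains.
Variables (R : comPzRingType) (C D : category) (pi : functor C D) (M : coef_system R C).

Local Notation over_proj d := (nerve_map (comma_proj pi d)).
Local Notation over_coef d := (coef_pull (comma_proj pi d) M).

Section Canonical.
Variables (q : nat) (s : nerve C q).

Definition nerve_last : C := s (ord_max : 'I_q.+1).

Definition can_over_obj (i : ordinal_cat q) : comma pi (pi nerve_last) :=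
  existT (fun x : C => hom (pi x) (pi nerve_last)) (s i)
    (fhom pi (@fhom _ _ s i ord_max (leq_ord i))).

Lemma can_over_subproof (i j : ordinal_cat q) (ij : hom i j) :
  projT2 (can_over_obj j) \oc fhom pi (fhom s ij) = projT2 (can_over_obj i).
Proof.
rewrite /= -!fhomM; congr (fhom pi (fhom s _)); exact: bool_irrelevance.
Qed.

Definition can_over_hom (i j : ordinal_cat q) (ij : hom i j) :
  hom (can_over_obj i) (can_over_obj j) := exist _ (fhom s ij) (can_over_subproof ij).

Lemma can_over1 i : can_over_hom (idm i) = idm (can_over_obj i).
Proof. by apply: comma_hom_eq; exact: fhom1. Qed.
Lemma can_overM (i j k : ordinal_cat q) (jk : hom j k) (ij : hom i j) :
  can_over_hom (jk \oc ij) = can_over_hom jk \oc can_over_hom ij.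
Proof. by apply: comma_hom_eq; exact: fhomM. Qed.

Definition can_over : nerve (comma pi (pi nerve_last)) q :=
  @Functor (ordinal_cat q) (comma pi (pi nerve_last)) can_over_obj can_over_hom can_over1 can_overM.

End Canonical.

Lemma can_over_proj q (s : nerve C q) :
  over_proj (pi (nerve_last s)) q (can_over s) = s.
Proof. case: s => o m i c; exact: (@functor_strict (ordinal_cat q) C o m _ _ i c). Qed.

(** The two sides have the same type because [nerve_last] sees only the object map; this avoids a
    transport in [coext_natural]. *)
Lemma can_over_irrelevance q o m i c i' c' :
  can_over (@Functor (ordinal_cat q) C o m i c) = can_over (@Functor (ordinal_cat q) C o m i' c').
Proof. by rewrite (Prop_irrelevance i i') (Prop_irrelevance c c'). Qed.

Definition over_last d q (s : nerve (comma pi d) q) :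
    @hom D (pi (nerve_last (over_proj d q s))) d :=
  projT2 (s (ord_max : 'I_q.+1)).

(** The arrow s_i -> s_q lies over d, so the structure map at s_i is the last one composed with its
    image: [can_over] is the universal lift of a simplex. *)
Lemma can_over_push d q (s : nerve (comma pi d) q) :
  nerve_map (comma_push pi (over_last s)) q (can_over (over_proj d q s)) = s.
Proof.
have e i : nerve_map (comma_push pi (over_last s)) q (can_over (over_proj d q s)) i = s i.
  apply: (etrans (y := existT (fun x : C => hom (pi x) d) (projT1 (s i)) (projT2 (s i)))).
    apply: (congr1 (existT (fun x : C => hom (pi x) d) (projT1 (s i)))).
    exact: (svalP (@fhom _ _ s i (ord_max : 'I_q.+1) (leq_ord i))).
  by case: (s i).
apply: (functor_ext (e := e)) => i j ij; apply: comma_hom_eq => /=.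
rewrite (sval_eqhom (e i) erefl) (sval_eqhom (e j) erefl).
by rewrite mcompm1 mcomp1m.
Qed.

Definition over_nt (d d' : D) (beta : hom d d') :
    nattrans (cochains (over_coef d')) (cochains (over_coef d)) :=
  nt_comp (cochain_coef (coef_pull_comp (comma_proj_push pi beta) M))
    (cochain_pull (nerve_map (comma_push pi beta)) (over_coef d')).

Section Degree.
Variable q : nat.

Definition over_cochain_ob (d : opcat D) : lmodType R := cochains (over_coef d) q.
Definition over_cochain_hom (d d' : opcat D) (beta : hom d d') :
  {linear over_cochain_ob d -> over_cochain_ob d'} := nt (over_nt beta) q.

Lemma over_cochain1 (d : opcat D) (x : over_cochain_ob d) : over_cochain_hom (idm d) x = x.
Proof.
apply: functional_extensionality_dep => s; rewrite -[RHS](mhom1 (m := M)).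
apply: (@mhom_transport _ _ _ (over_proj d) M q x) => //.
exact: etrans (congr1 (fun F => fcomp F s) (comma_push1 pi d)) (id_fcomp _).
Qed.
Lemma over_cochainM (a b c : opcat D) (g : hom b c) (f : hom a b) (x : over_cochain_ob a) :
  over_cochain_hom (g \oc f) x = over_cochain_hom g (over_cochain_hom f x).
Proof.
apply: functional_extensionality_dep => s; symmetry.
apply: etrans; first by symmetry; exact: (mhomM (m := M)).
apply: (@mhom_transport _ _ _ (over_proj a) M q x).
  exact: etrans (fcompA _ _ _)
    (esym (congr1 (fun F => fcomp F s) (@comma_pushM _ _ pi c b a f g))).
exact: simplex_hom_eq.
Qed.

Definition over_cochain : modfun R (opcat D) := ModFun over_cochain1 over_cochainM.

Lemma over_cochain_homE (d d' : opcat D) (beta : hom d d') (x : over_cochain d) s :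
  mhom over_cochain beta x s =
  mhom M (simplex_eq (pull_comp_eq (comma_proj_push pi (beta : @hom D d' d)) s))
    (x (nerve_map (comma_push pi beta) q s)).
Proof. by []. Qed.

Definition ev_can (s : nerve C q) (x : over_cochain (pi (nerve_last s))) : M (existT _ q s) :=
  mhom M (simplex_eq (can_over_proj s)) (x (can_over s)).

Lemma ev_can_linear s : linear (@ev_can s).
Proof. by move=> a x y; exact: (linearP (mhom M _)). Qed.

(** The coinduced structure: a cochain is recovered from its restrictions to the objects pi(s_q),
    evaluated on universal lifts. *)
Lemma over_cochain_ev (d : opcat D) (x : over_cochain d) s :
  x s = @ev_can (over_proj d q s) (@mhom _ _ over_cochain d _ (over_last s) x).
Proof.
rewrite /ev_can over_cochain_homE -mhomM -[LHS](mhom1 (m := M)).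
apply: (@mhom_transport _ _ _ (over_proj d) M q x); first by rewrite can_over_push.
exact: simplex_hom_eq.
Qed.

Section Extension.
Variables (A B : modfun R (opcat D)) (i : nattrans A B).
Variable r : forall d, {linear B d -> A d}.
Hypothesis ri : forall d x, r d (nt i d x) = x.
Variable phi : nattrans A over_cochain.

(* A map into a coinduced module is determined by its components at the objects *)
(* pi(s_q), and these components need only be linear.                           *)
Definition coext_fun (d : opcat D) (b : B d) : over_cochain d := fun s =>
  @ev_can (over_proj d q s) (nt phi _ (r _ (@mhom _ _ B d _ (over_last s) b))).

Lemma coext_linear d : linear (@coext_fun d).
Proof.
move=> a x y; apply: functional_extensionality_dep => s.
rewrite /coext_fun linearP.
rewrite [r _ _]linearP [nt phi _ _]linearP.
exact: ev_can_linear.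
Qed.

Lemma coext_natural (d d' : opcat D) (beta : hom d d') (b : B d) :
  coext_fun (mhom B beta b) = mhom over_cochain beta (coext_fun b).
Proof.
apply: functional_extensionality_dep => s.
rewrite [RHS]over_cochain_homE /coext_fun /ev_can -[in RHS]mhomM -[in LHS]mhomM.
apply: (@mhom_transport _ _ _ (over_proj _) M q).
  exact: can_over_irrelevance.
exact: simplex_hom_eq.
Qed.

Definition coext : nattrans B over_cochain :=
  @mk_nt R _ B over_cochain (fun d => mk_linear (@coext_linear d)) coext_natural.

(** Naturality of [i] brings the restriction inside, where [r] undoes [i]; naturality of [phi] and
    [over_cochain_ev] conclude. *)
Lemma coextE d x : nt coext d (nt i d x) = nt phi d x.
Proof.
apply: functional_extensionality_dep => s; rewrite [RHS]over_cochain_ev.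
rewrite -[LHS]/(ev_can _) -[mhom B _ _](ntN i) ri.
by rewrite ntN.
Qed.

End Extension.

Lemma const_pull_subproof (zeta : cochains M q) (d : opcat D) :
  linear (fun r : (R^o : lmodType R) =>
    r *: nt (cochain_pull (over_proj d) M) q zeta : over_cochain d).
Proof. by move=> a x y; rewrite scalerDl scalerA. Qed.

Lemma const_pull_natural (zeta : cochains M q) (d d' : opcat D) (beta : hom d d')
    (r : (R^o : lmodType R)) :
  r *: nt (cochain_pull (over_proj d') M) q zeta =
  mhom over_cochain beta (r *: nt (cochain_pull (over_proj d) M) q zeta).
Proof.
rewrite [RHS](linearZ_LR (mhom over_cochain beta)); congr (_ *: _); apply: functional_extensionality_dep => s.
rewrite [RHS]over_cochain_homE -[LHS](mhom1 (m := M)).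
apply: (@mhom_transport _ _ _ (smap_id (nerve C)) M q zeta) => //.
exact: (esym (pull_comp_eq (comma_proj_push pi (beta : @hom D d' d)) s)).
Qed.

Definition const_pull (zeta : cochains M q) :
    nattrans (const_modfun (opcat D) (R^o : lmodType R)) over_cochain :=
  @mk_nt R _ (const_modfun (opcat D) (R^o : lmodType R)) over_cochain
    (fun d => mk_linear (const_pull_subproof zeta d)) (const_pull_natural zeta).

Lemma const_pullE zeta d r s : nt (const_pull zeta) d r s = r *: zeta (over_proj d q s).
Proof. by []. Qed.

(** By linearity and naturality [phi] is determined by the images of 1 over the objects pi(s_q), so
    the cochain only has to record these on the universal lifts. *)
Lemma const_pull_surj (phi : nattrans (const_modfun (opcat D) (R^o : lmodType R)) over_cochain) :
  exists zeta, const_pull zeta = phi.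
Proof.
exists (fun s => @ev_can s (nt phi (pi (nerve_last s)) 1)).
apply: nt_eq => d r; apply: functional_extensionality_dep => s.
rewrite const_pullE.
have -> : nt phi d r = r *: nt phi d 1.
  by rewrite -(linearZ_LR (nt phi d)); congr (nt phi d _); exact: esym (mulr1 r).
rewrite -[RHS]/(r *: nt phi d 1 s); congr (_ *: _).
rewrite [RHS]over_cochain_ev; congr ev_can.
exact: (ntN phi).
Qed.

Lemma const_pull_inj zeta : const_pull zeta = 0 -> zeta = 0.
Proof.
move=> z0; apply: functional_extensionality_dep => s.
have : nt (const_pull zeta) (pi (nerve_last s)) 1 (can_over s) = 0 by rewrite z0.
rewrite const_pullE scale1r => /(congr1 (mhom M (simplex_eq (can_over_proj s)))).
move=> zs; apply: etrans (etrans zs (raddf0 _)); rewrite -[LHS](mhom1 (m := M)).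
apply: (@mhom_transport _ _ _ (smap_id (nerve C)) M q zeta) => //.
exact: esym (can_over_proj s).
Qed.

End Degree.

Lemma over_cochain_d_natural q (d d' : opcat D) (beta : hom d d') (x : over_cochain q d) :
  cd (cosimplicial_complex (cochains (over_coef d'))) q (mhom (over_cochain q) beta x) =
  mhom (over_cochain q.+1) beta (cd (cosimplicial_complex (cochains (over_coef d))) q x).
Proof. exact: (esym (cmd (cosimplicial_cmap (over_nt (beta : @hom D d' d))) x)). Qed.

Definition over_cochain_d q : nattrans (over_cochain q) (over_cochain q.+1) :=
  @mk_nt R (opcat D) (over_cochain q) (over_cochain q.+1)
    (fun d => cd (cosimplicial_complex (cochains (over_coef d))) q)
    (@over_cochain_d_natural q).

Lemma over_cochain_dd q d (x : over_cochain q d) :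
  nt (over_cochain_d q.+1) d (nt (over_cochain_d q) d x) = 0.
Proof. exact: (cdd (c := cosimplicial_complex (cochains (over_coef d)))). Qed.

Section Class.
Variable q : nat.

Lemma over_cls_subproof (d : opcat D) (z : ker_modfun (over_cochain_d q) d) :
  val z \in cocycles (cosimplicial_complex (cochains (over_coef d))) q.
Proof. by apply/submod_ofP; have /submod_ofP := valP z. Qed.

Definition over_cls_fun (d : opcat D) (z : ker_modfun (over_cochain_d q) d) :
    thomason_over pi M q d :=
  subclass _ (exist _ (val z) (over_cls_subproof z)).

Lemma over_cls_linear d : linear (@over_cls_fun d).
Proof.
move=> a x y; apply: etrans (subclass_linear _ _ _ _).
by congr subclass; exact: val_inj.
Qed.

Lemma over_cls_natural (d d' : opcat D) (beta : hom d d') (z : ker_modfun (over_cochain_d q) d) :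
  over_cls_fun (mhom (ker_modfun (over_cochain_d q)) beta z) =
  mhom (thomason_over pi M q) beta (over_cls_fun z).
Proof.
symmetry; apply: (etrans (over_homE (beta : @hom D d' d) _)).
apply: (etrans (subq_map_class _ _ _)).
by congr subclass; exact: val_inj.
Qed.

Definition over_cls : nattrans (ker_modfun (over_cochain_d q)) (thomason_over pi M q) :=
  @mk_nt R (opcat D) (ker_modfun (over_cochain_d q)) (thomason_over pi M q)
    (fun d => mk_linear (@over_cls_linear d)) over_cls_natural.

Lemma over_cls_surj : nt_surj over_cls.
Proof.
move=> d x; have [z <-] := subclass_surj x.
have zk : val z \in submod_of (@in_ker0 _ _ _ _ (over_cochain_d q) d)
    (@in_kerL _ _ _ _ (over_cochain_d q) d).
  by apply/submod_ofP; have /submod_ofP := valP z.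
exists (exist _ (val z) zk); rewrite -[LHS]/(subclass _ _).
by congr subclass; exact: val_inj.
Qed.

Lemma over_cls_ker d (z : ker_modfun (over_cochain_d q) d) :
  nt over_cls d z = 0 <->
  im_delta over_cochain_d (nt (ker_incl (over_cochain_d q)) d z).
Proof.
apply: (iff_trans (subclass0P _ _)); apply: (iff_trans (submod_ofP _ _ _)) => /=.
by case: q z.
Qed.

End Class.

End OverCochains.

(** * Objectwise splitting of the free resolution *)

Section SplitFreeResolution.
Variables (R : comPzRingType) (E : category).

Lemma surj_descend (A A' B : modfun R E) (f : nattrans A A') (phi : nattrans A B) :
  nt_surj f -> (forall e x, nt f e x = 0 -> nt phi e x = 0) ->
  exists psi : nattrans A' B, nt_comp psi f = phi.
Proof.
move=> fs fphi.
pose g e y := nt phi e (sval (cid (fs e y))).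
have gE e x : g e (nt f e x) = nt phi e x.
  rewrite /g; case: cid => x' /= xx'; apply: subr0_eq.
  apply: etrans (esym (raddfB (nt phi e) _ _)) _; apply: fphi.
  apply: etrans (raddfB (nt f e) _ _) _.
  exact: etrans (congr1 (fun y => y - _) xx') (subrr _).
have gL e : linear (g e).
  move=> a y y'; have [x <-] := fs e y; have [x' <-] := fs e y'.
  apply: etrans (congr1 (g e) (esym (linearP (nt f e) a x x'))) _; rewrite !gE.
  exact: (linearP (nt phi e)).
have gN a b (k : hom a b) (y : A' a) : g b (mhom A' k y) = mhom B k (g a y).
  by have [x <-] := fs a y; rewrite -(ntN f) !gE (ntN phi).
exists (@mk_nt R E A' B (fun e => mk_linear (gL e)) gN).
by apply: nt_eq => e x; exact: gE.
Qed.

Section Syzygies.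
Variable A : modfun R E.
Hypothesis A_split : forall e, exists s : {linear A e -> free_modfun A e},
  forall x, nt (free_cover A) e (s x) = x.

(** The retraction is the identity minus the section composed with the cover. It lives at a single
    object, which is all that [coext] asks for. *)
Lemma ker_retraction (B : modfun R E) e (s : {linear B e -> free_modfun B e}) :
  (forall x, nt (free_cover B) e (s x) = x) ->
  exists r : {linear free_modfun B e -> ker_modfun (free_cover B) e},
    forall y, r (nt (ker_incl (free_cover B)) e y) = y.
Proof.
move=> sK.
pose f : {linear free_modfun B e -> free_modfun B e} := idfun \- (s \o nt (free_cover B) e).
have fk u : f u \in submod_of (@in_ker0 _ _ _ _ (free_cover B) e)
    (@in_kerL _ _ _ _ (free_cover B) e).
  apply/submod_ofP; apply: etrans (raddfB (nt (free_cover B) e) _ _) _.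
  by rewrite [X in _ - X]sK subrr.
pose r u : ker_modfun (free_cover B) e := exist _ (f u) (fk u).
have rL : linear r by move=> a u v; apply: val_inj; exact: (linearP f).
exists (mk_linear rL) => y; apply: val_inj; rewrite -[LHS]/(val y - s (nt (free_cover B) e (val y))).
have -> : nt (free_cover B) e (val y) = 0 by have /submod_ofP := valP y.
by rewrite raddf0 subr0.
Qed.

(* The section of the next cover is the linear extension of [r] from the basis  *)
(* of the free module, restricted to the syzygy.                                *)
Lemma syzygy_split n e : exists s : {linear syzygy A n e -> free_modfun (syzygy A n) e},
  forall x, nt (free_cover (syzygy A n)) e (s x) = x.
Proof.
elim: n => [|n [s sK]]; first exact: A_split.
have [r rK] := ker_retraction sK.
(* A generator goes to the generator for its retraction, placed at the identity of [e], where the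
   cover is evaluation. *)
pose h : {linear free_modfun (syzygy A n) e -> free_modfun (syzygy A n.+1) e} :=
  free_lift (fun t => gen R (elt (r (gen R t) : syzygy A n.+1 e) (idm e))).
have hE u : nt (free_cover (syzygy A n.+1)) e (h u) = r u.
  apply: (@free_ext _ _ _ (nt (free_cover (syzygy A n.+1)) e \o h) r) => t.
  apply: etrans (congr1 (nt (free_cover (syzygy A n.+1)) e) (free_lift_gen _ _)) _.
  apply: etrans (free_lift_gen _ _) _; exact: (mhom1 (m := syzygy A n.+1)).
exists (h \o nt (ker_incl (free_cover (syzygy A n))) e) => x.
by apply: etrans (hE _) _; exact: rK.
Qed.

Lemma syzygy_retraction n e :
  exists r : {linear free_res_ob A n e -> syzygy A n.+1 e},
    forall y, r (nt (ker_incl (free_cover (syzygy A n))) e y) = y.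
Proof. by have [s sK] := syzygy_split n e; exact: ker_retraction sK. Qed.

End Syzygies.

(** Base case of [syzygy_split]: R is free of rank one, so a section is fixed by a preimage of 1. *)
Lemma const_split (e : E) :
  exists s : {linear const_modfun E (R^o : lmodType R) e ->
              free_modfun (const_modfun E (R^o : lmodType R)) e},
    forall x, nt (free_cover (const_modfun E (R^o : lmodType R))) e (s x) = x.
Proof.
pose A := const_modfun E (R^o : lmodType R).
pose g : free_modfun A e := gen R (@elt R E A e e (1 : R^o) (idm e)).
have sL : linear (fun x : A e => (x : R) *: g).
  by move=> a x y; rewrite scalerDl scalerA.
exists (mk_linear sL) => x.
apply: etrans (linearZ_LR (nt (free_cover A) e) _ _) _.
rewrite [nt _ e g]free_lift_gen; exact: mulr1.
Qed.

End SplitFreeResolution.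

(** * Exactness of the augmented rows and the spectral sequence of a functor *)

Section Rows.
Variables (R : comPzRingType) (C D : category) (pi : functor C D) (M : coef_system R C).

Local Notation Rconst := (const_modfun (opcat D) (R^o : lmodType R)).
Local Notation P := (free_resolution Rconst).
Local Notation X := (over_cochain pi M).

(** A cocycle [phi] descends to the syzygy covered by P_{p+1}; [coext] then extends it to P_p along
    the objectwise split inclusion. *)
Lemma row_exact p q (phi : nattrans (P p.+1) (X q)) :
  hom_d phi = 0 -> exists psi : nattrans (P p) (X q), hom_d psi = phi.
Proof.
move=> phi0.
have [xi xiE] : exists xi : nattrans (syzygy Rconst p.+1) (X q),
    nt_comp xi (free_cover (syzygy Rconst p.+1)) = phi.
  apply: surj_descend; first exact: cover_surj.
  move=> e x /free_res_exactP[y <-].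
  by rewrite -[LHS]/(nt (hom_d phi) e y) phi0.
have rE e := cid (syzygy_retraction (@const_split R (opcat D)) p e).
pose r e := sval (rE e).
have ri e y : r e (nt (ker_incl (free_cover (syzygy Rconst p))) e y) = y.
  by rewrite /r; case: (rE e).
exists (coext r xi); apply: nt_eq => e u.
rewrite -[RHS](congr1 (fun f => nt f e u) xiE).
exact: (coextE ri xi (nt (free_cover (syzygy Rconst p.+1)) e u)).
Qed.

Definition row_aug_fun q (zeta : cochains M q) : nattrans (P 0) (X q) :=
  nt_comp (const_pull pi zeta) (pr_aug P).
Lemma row_aug_linear q : linear (@row_aug_fun q).
Proof.
move=> a u v; apply: nt_eq => e x; rewrite -[LHS]/(nt (pr_aug P) e x *:
  nt (cochain_pull (nerve_map (comma_proj pi e)) M) q (a *: u + v)).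
apply: etrans (congr1 (fun w => nt (pr_aug P) e x *: w)
  (linearP (nt (cochain_pull (nerve_map (comma_proj pi e)) M) q) a u v)) _.
by rewrite scalerDr scalerA mulrC -scalerA.
Qed.
Definition row_aug q : {linear cochains M q -> nattrans (P 0) (X q)} :=
  mk_linear (@row_aug_linear q).

Lemma row_aug_inj q zeta : row_aug q zeta = 0 -> zeta = 0.
Proof.
move=> z0; apply: (@const_pull_inj _ _ _ pi M); apply: nt_eq => e y.
have [x <-] := @pr_surj _ _ _ P e y.
exact: (congr1 (fun f => nt f e x) z0).
Qed.

(** A map killed by the first differential descends to R, and maps from R to X^q are cochains by
    [const_pull_surj]. *)
Lemma row_aug_ex q (x : nattrans (P 0) (X q)) :
  hom_d x = 0 <-> exists zeta, row_aug q zeta = x.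
Proof.
split=> [x0|[zeta <-]].
  have [xi xiE] : exists xi : nattrans Rconst (X q), nt_comp xi (pr_aug P) = x.
    apply: surj_descend; first exact: pr_surj.
    move=> e u /pr_exact0[y <-].
    by rewrite -[LHS]/(nt (hom_d x) e y) x0.
  by have [zeta zE] := const_pull_surj xi; exists zeta; rewrite /= /row_aug_fun zE.
apply: nt_eq => e u.
rewrite -[LHS]/(nt (const_pull pi zeta) e (nt (pr_aug P) e (nt (pr_d P 0) e u))).
have -> : nt (pr_aug P) e (nt (pr_d P 0) e u) = 0 by apply/pr_exact0; exists u.
exact: raddf0.
Qed.

Lemma row_aug_d q (c : cosimplicial_complex (cochains M) q) :
  row_aug q.+1 (cd (cosimplicial_complex (cochains M)) q c) =
  hom_v P (over_cochain_d pi M) 0 q (row_aug q c).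
Proof.
apply: nt_eq => e u.
rewrite -[LHS]/(nt (pr_aug P) e u *:
  nt (cochain_pull (nerve_map (comma_proj pi e)) M) q.+1
    (cd (cosimplicial_complex (cochains M)) q c)).
rewrite -[RHS]/(nt (over_cochain_d pi M q) e (nt (pr_aug P) e u *:
  nt (cochain_pull (nerve_map (comma_proj pi e)) M) q c)).
rewrite [RHS](linearZ_LR (nt (over_cochain_d pi M q) e)); congr (_ *: _).
exact: (cmd (cosimplicial_cmap (cochain_pull (nerve_map (comma_proj pi e)) M)) c).
Qed.

Lemma thomason_spectral_sequence : exists S : spectral_sequence R,
  (forall p q, linear_iso (S 2%N p q) (cat_cohomology (thomason_over pi M q) p)) /\
  converges S (thomason M).
Proof.
exists (hyper_spectral P (@over_cochain_dd _ _ _ pi M)); split=> [p q|].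
  exact: (hyper_spectral2 P (@over_cochain_dd _ _ _ pi M)
    (@over_cls_surj _ _ _ pi M) (@over_cls_ker _ _ _ pi M)).
apply: (@hyper_spectral_converges _ _ _ P _ _ (@over_cochain_dd _ _ _ pi M)
  (cosimplicial_complex (cochains M)) row_aug).
- exact: row_aug_d.
- exact: row_aug_inj.
- exact: row_aug_ex.
- exact: row_exact.
Qed.

End Rows.

Local Close Scope ring_scope.

Theorem theorem1p3 (R : comPzRingType) (D : category) (F : cat_functor D)
    (M : coef_system R (grothendieck F)) :
  exists E : spectral_sequence R,
    (forall p q : nat,
       linear_iso (E 2 p q) (cat_cohomology (thomason_over (gproj F) M q) p)) /\
    converges E (thomason M).
Proof. exact: thomason_spectral_sequence. Qed.
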